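(* Let $\psi:\mathbb{R}\to\mathbb{R}$ be a real wavelet, let $\mathcal{H}\{\psi\}$ be its Hilbert transform, and let $\psi_H$ be an associated Hartley-Like wavelet, i.e. $\psi_H(t)=\frac{1}{\sqrt2}\left[\psi(t)\mp\mathcal{H}\{\psi\}(t)\right]$ for either choice of the sign. Then $\psi_H$ is also a real wavelet, and it has the same energy and the same admissibility coefficient as $\psi$, that is, $\mathcal{E}[\psi_H]=\mathcal{E}[\psi]$ and $C[\psi_H]=C[\psi]$.
   Context: The Fourier transform of $f\in L^2(\mathbb{R})$ is the $L^2$ Fourier transform with the convention $F(\omega)=\int_{-\infty}^{\infty} f(t)e^{-j\omega t}\,dt$, where $j=\sqrt{-1}$. The energy of $f$ is $\mathcal{E}[f]=\int_{-\infty}^{\infty}|f(t)|^2\,dt$. The admissibility coefficient of $f$ is $C[f]=\int_{-\infty}^{\infty}\frac{|F(\omega)|^2}{|\omega|}\,d\omega$. A function $f$ is a (mother) wavelet if and only if (i) $f\in L^2(\mathbb{R})$ (finite energy) and (ii) $f$ satisfies the admissibility condition $C[f]<+\infty$. A real wavelet is a real-valued wavelet. The Hilbert transform of $f$ is $\mathcal{H}\{f\}(t)=\mathrm{p.v.}\,\frac{1}{\pi}\int_{-\infty}^{\infty}\frac{f(\tau)}{t-\tau}\,d\tau$ (Cauchy principal value); equivalently, the Fourier transform of $\mathcal{H}\{f\}$ is $-j\,\mathrm{sgn}(\omega)F(\omega)$, where $\mathrm{sgn}(\omega)=1,0,-1$ for $\omega>0$, $\omega=0$, $\omega<0$ respectively.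 *)

(* Defs.v *)
From mathcomp Require Import all_boot all_order all_algebra.
From mathcomp Require Import all_classical all_reals all_analysis.
From mathcomp Require Import complex.

Set Implicit Arguments.
Unset Strict Implicit.
Unset Printing Implicit Defensive.

Import Order.TTheory GRing.Theory Num.Theory.
Import numFieldNormedType.Exports ComplexField.Normc.

Local Open Scope classical_set_scope.
Local Open Scope ring_scope.
Local Open Scope complex_scope.

Definition to_complex (R : realType) (f : R -> R) : R -> R[i] :=
  fun t => (f t)%:C.

Definition cis (R : realType) (x : R) : R[i] := cos x +i* sin x.

(* The library has no measurable structure on R[i]: a complex function is
   measurable, and is integrated, componentwise. Measurability on R is Borel
   measurability; every class in L^2 has a Borel representative. *)
Definition cmeasurable (R : realType) (f : R -> R[i]) : Prop :=
  measurable_fun setT (fun t => complex.Re (f t)) /\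
  measurable_fun setT (fun t => complex.Im (f t)).

Definition cintegral (R : realType) (D : set R) (f : R -> R[i]) : R[i] :=
  Rintegral (@lebesgue_measure R) D (fun t => complex.Re (f t)) +i*
  Rintegral (@lebesgue_measure R) D (fun t => complex.Im (f t)).

Definition energy (R : realType) (f : R -> R[i]) : \bar R :=
  (\int[@lebesgue_measure R]_t (normc (f t) ^+ 2)%:E)%E.

Definition L2 (R : realType) (f : R -> R[i]) : Prop :=
  cmeasurable f /\ (energy f < +oo)%E.

Definition truncated_fourier (R : realType) (f : R -> R[i]) (A w : R) : R[i] :=
  cintegral `[- A, A] (fun t => f t * cis (- (w * t))).

(* L^2 Fourier transform (Plancherel): F is the limit in quadratic mean of the
   transforms of the truncations of f, which are integrable when f is in L^2.
   Such an F is determined up to equality almost everywhere. *)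
Definition is_fourier (R : realType) (f F : R -> R[i]) : Prop :=
  L2 F /\
  energy (fun w => truncated_fourier f A w - F w) @[A --> +oo] --> 0%E.

(* A representative of the transform. It exists for f in L^2; the default value
   0 is only used for f outside L^2. *)
Definition fourier (R : realType) (f : R -> R[i]) : R -> R[i] :=
  xget (fun=> 0) [set F | is_fourier f F].

(* The value of the integrand at w = 0, where x / 0 = 0, is irrelevant. *)
Definition admissibility (R : realType) (f : R -> R[i]) : \bar R :=
  (\int[@lebesgue_measure R]_w (normc (fourier f w) ^+ 2 / `|w|)%:E)%E.

Definition wavelet (R : realType) (f : R -> R[i]) : Prop :=
  L2 f /\ (admissibility f < +oo)%E.

Definition real_wavelet (R : realType) (f : R -> R) : Prop :=
  wavelet (to_complex f).

(* Cauchy principal value at tau = t. For f in L^2 the truncated integrals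
   converge absolutely, and the limit exists for almost every t; at the other
   points [lim] returns a fixed default value. *)
Definition hilbert (R : realType) (f : R -> R) (t : R) : R :=
  lim (pi^-1 * Rintegral (@lebesgue_measure R)
                 [set tau | eps < `|t - tau|] (fun tau => f tau / (t - tau))
       @[eps --> 0^'+]).

(* [s = false] is the sign -, [s = true] is the sign +. *)
Definition hartley_like (R : realType) (s : bool) (f : R -> R) (t : R) : R :=
  (Num.sqrt 2)^-1 * (f t - (-1) ^+ s * hilbert f t).

(* Main.v *)
From HB Require Import structures.
Require Import Defs.
From mathcomp Require Import all_boot all_order all_algebra.
From mathcomp Require Import all_classical all_reals all_analysis.
From mathcomp Require Import measurable_realfun complex.
From mathcomp Require Import ring lra.

Set Implicit Arguments.
Unset Strict Implicit.
Unset Printing Implicit Defensive.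

Import Order.TTheory GRing.Theory Num.Theory.
Import numFieldNormedType.Exports.

Local Open Scope classical_set_scope.
Local Open Scope ring_scope.

(** For a real function [f] the complex transform [F] and the real Hartley
    transform [h w = \int f(t) (cos (w t) + sin (w t)) dt] carry the same
    information: [Re F] is the even part of [h] and [- Im F] its odd part, so that
    [|F w|^2 = (h w ^ 2 + h (-w) ^ 2) / 2].  The argument is therefore carried out
    with [h], and every function in it is real.

    The Hilbert transform multiplies [F] by [- j sgn w]; on the Hartley side it
    sends [h w] to [sgn w * h (- w)].  Hence the Hartley-like wavelet has the
    transform [h' w = (h w -+ sgn w * h (- w)) / sqrt 2], and in the sum
    [h' w ^ 2 + h' (- w) ^ 2] the two cross terms cancel because [sgn] is odd:
    its Fourier transform [F'] satisfies [|F'|^2 = |F|^2] at every nonzero frequency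
    ([sqr_hartley_like_hart]).  The equality of the admissibility coefficients is
    immediate, and that of the energies follows from Plancherel's identity.

    What remains is to justify this for the transforms as they are defined, that is
    as a limit in quadratic mean and as a pointwise principal value.

    Plancherel.  Damping by [exp (- e |w|)] turns the energy of the transform into
    a quadratic form with the Poisson kernel, whose total mass is [pi]; the
    inequality [2 a b <= a^2 + b^2] then gives Bessel's inequality ([bessel_L1]) for
    integrable functions.  Together with the completeness of the space of square
    integrable functions it yields the transform of every square-integrable
    function ([is_hart_exists]).  The same damping shows that the transform applied
    twice gives the limit of the Poisson averages of [2 pi f], which is [2 pi f]
    almost everywhere ([is_hart_involutive]); so Bessel's inequality is an
    equality ([sqnorm_is_hart]) and the transform is onto.

    Principal value.  Let [g] be the function whose Hartley transform is
    [sgn w * h (- w)].  The multiplication formula shows that the Poisson average of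
    [g] equals, at every point, the average of [f] against the conjugate Poisson
    kernel [s / (e^2 + s^2)] ([pois_conv_sgflip]).  That kernel differs from the
    truncated kernel [1 / s] by an odd function bounded by the Poisson kernel, and
    averages of [f - f x] against such kernels vanish in the limit when [x] is a
    Lebesgue point ([cvg_Rintegral_lebesgue_kernel]).  So the principal value exists
    and equals [g] almost everywhere ([hilbert_ae_eq]).  It is Borel measurable
    because its existence can be tested on rational truncations
    ([measurable_hilbert]). *)

(** * Measurability, reflections and null sets *)

Section measurability.
Context {R : realType}.
Notation mu := (@lebesgue_measure R).

(** The identity [x^-1 = x * (x^2)^-1] also holds at [0] and reduces the inverse to
    a power function, whose measurability is known. *)
Lemma measurable_funV d (T : measurableType d) (D : set T) (f : T -> R) :
  measurable_fun D f -> measurable_fun D (fun x => (f x)^-1).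
Proof.
move=> mf.
rewrite (_ : (fun x => (f x)^-1) = fun x => f x * powR (f x ^+ 2) (-1)).
  apply: measurable_funM => //.
  apply: (measurableT_comp (f := fun y : R => powR y (-1))); first exact: measurable_powR.
  exact: measurable_funX.
apply/funext => x.
have [->|fx0] := eqVneq (f x) 0; first by rewrite invr0 mul0r.
by rewrite powR_inv1 ?sqr_ge0// expr2 invfM mulrA mulfV// mul1r.
Qed.

Lemma measurable_fun_norm d (T : measurableType d) (D : set T) (f : T -> R) :
  measurable_fun D f -> measurable_fun D (fun x => `|f x|).
Proof. by move=> mf; apply: (measurableT_comp (f := @Num.norm R R)). Qed.

Lemma measurable_fun_expR d (T : measurableType d) (D : set T) (f : T -> R) :
  measurable_fun D f -> measurable_fun D (fun x => expR (f x)).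
Proof. by move=> mf; apply: (measurableT_comp (f := @expR R)). Qed.

Definition cas (x : R) : R := cos x + sin x.

Lemma measurable_fun_cos d (T : measurableType d) (D : set T) (f : T -> R) :
  measurable_fun D f -> measurable_fun D (fun x => cos (f x)).
Proof.
move=> mf; apply: (measurableT_comp (f := @cos R)) => //.
by apply: continuous_measurable_fun; exact: continuous_cos.
Qed.

Lemma measurable_fun_sin d (T : measurableType d) (D : set T) (f : T -> R) :
  measurable_fun D f -> measurable_fun D (fun x => sin (f x)).
Proof.
move=> mf; apply: (measurableT_comp (f := @sin R)) => //.
by apply: continuous_measurable_fun; exact: continuous_sin.
Qed.

Lemma measurable_fun_cas d (T : measurableType d) (D : set T) (f : T -> R) :
  measurable_fun D f -> measurable_fun D (fun x => cas (f x)).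
Proof.
by move=> mf; apply: measurable_funD; [exact: measurable_fun_cos|exact: measurable_fun_sin].
Qed.

Lemma measurable_fun_sg d (T : measurableType d) (D : set T) (f : T -> R) :
  measurable_fun D f -> measurable_fun D (fun x => Num.sg (f x)).
Proof.
move=> mf; rewrite (_ : (fun x => _) = fun x => f x / `|f x|).
  by apply: measurable_funM => //; apply: measurable_funV; exact: measurable_fun_norm.
apply/funext => x; have [->|fx0] := eqVneq (f x) 0; first by rewrite sgr0 mul0r.
by rewrite {2}(numEsg (f x)) mulfK// normr_eq0.
Qed.

Lemma measurable_set_ler d (T : measurableType d) (f g : T -> R) :
  measurable_fun setT f -> measurable_fun setT g -> measurable [set x | f x <= g x].
Proof.
move=> mf mg; rewrite -[X in measurable X]setTI.
exact: (measurable_fun_ler mf mg measurableT (Y := [set true])).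
Qed.

Lemma measurable_set_ltr d (T : measurableType d) (f g : T -> R) :
  measurable_fun setT f -> measurable_fun setT g -> measurable [set x | f x < g x].
Proof.
move=> mf mg; rewrite -[X in measurable X]setTI.
exact: (measurable_fun_ltr mf mg measurableT (Y := [set true])).
Qed.

End measurability.

Ltac mfun := repeat first
  [ assumption | exact: measurable_cst | exact: measurable_id
  | exact: measurable_fst | exact: measurable_snd
  | apply: measurable_funD | apply: measurable_funB | apply: measurable_funM
  | apply: measurable_funN
  | apply: measurable_funX | apply: measurable_funV | apply: measurable_fun_norm
  | apply: measurable_fun_expR | apply: measurable_fun_cas
  | apply: measurable_fun_cos | apply: measurable_fun_sin
  | apply: measurable_fun_sg ].

Section substitution.
Context {R : realType}.
Notation mu := (@lebesgue_measure R).
Local Open Scope ereal_scope.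

(** Reflections preserve the length of intervals, hence the whole measure. *)
Lemma lebesgue_measure_reflect (c : R) (A : set R) : measurable A ->
  pushforward mu ((fun x => c - x)%R : measurableTypeR R -> measurableTypeR R) A = mu A.
Proof.
move=> mA.
have mphi : measurable_fun setT ((fun x => c - x)%R : measurableTypeR R -> measurableTypeR R).
  by apply: measurable_funB.
pose phi : {mfun measurableTypeR R >-> measurableTypeR R} := HB.pack
  ((fun x => c - x)%R : measurableTypeR R -> measurableTypeR R)
  (isMeasurableFun.Build _ _ _ _ _ mphi).
apply/esym/(@lebesgue_measure_unique R (pushforward mu phi)) => //= _ [[a b]] _ <-.
rewrite /pushforward (_ : _ @^-1` _ = `[c - b, c - a[%classic)%R; last first.
  by apply/seteqP; split => x /=; rewrite !in_itv/=; lra.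
by rewrite !lebesgue_measure_itv/= !lte_fin ltrD2l ltrN2 -!EFinB; case: ifP => // _; congr EFin; ring.
Qed.

Lemma ge0_integral_reflect (c : R) (f : R -> \bar R) :
  measurable_fun setT f -> (forall x, 0 <= f x) ->
  \int[mu]_x f (c - x)%R = \int[mu]_x f x.
Proof.
move=> mf f0.
have mphi : measurable_fun setT ((fun x => c - x)%R : measurableTypeR R -> measurableTypeR R).
  by apply: measurable_funB.
transitivity (\int[pushforward mu
  ((fun x => c - x)%R : measurableTypeR R -> measurableTypeR R)]_x f x).
  by rewrite ge0_integral_pushforward.
by apply: eq_measure_integral => A mA _; exact: lebesgue_measure_reflect.
Qed.

End substitution.

Section almost_everywhere.
Context {R : realType}.
Notation mu := (@lebesgue_measure R).
Implicit Types P Q : R -> Prop.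

Lemma aeW P : (forall x, P x) -> {ae mu, forall x, P x}.
Proof. by move=> AP; exists set0; split => // x /(_ (AP x)). Qed.

Lemma aeS P Q : (forall x, P x -> Q x) ->
  {ae mu, forall x, P x} -> {ae mu, forall x, Q x}.
Proof.
by move=> PQ [N [mN N0 sN]]; exists N; split => // x nQ; apply: sN => /PQ.
Qed.

Lemma aeI P Q : {ae mu, forall x, P x} -> {ae mu, forall x, Q x} ->
  {ae mu, forall x, P x /\ Q x}.
Proof.
move=> [N [mN N0 sN]] [M [mM M0 sM]]; exists (N `|` M); split => //.
- exact: measurableU.
- by rewrite null_set_setU.
- move=> x /= nPQ; have [Px|nPx] := pselect (P x); last by left; apply: sN.
  by right; apply: sM => Qx; apply: nPQ.
Qed.

End almost_everywhere.

(** * Square-integrable real functions *)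

Section square_integrable.
Context {R : realType}.
Notation mu := (@lebesgue_measure R).
Notation integrableR f := (mu.-integrable setT (EFin \o f%R)).
Implicit Types f g h : R -> R.

Definition sqnorm f : \bar R := (\int[mu]_x (f x ^+ 2)%:E)%E.

Definition sqint f := measurable_fun setT f /\ (sqnorm f < +oo)%E.

Lemma sqnorm_ge0 f : (0 <= sqnorm f)%E.
Proof. by apply: integral_ge0 => x _; rewrite lee_fin sqr_ge0. Qed.

Lemma measurable_fun_sqr_EFin f : measurable_fun setT f ->
  measurable_fun setT (fun x => (f x ^+ 2)%:E).
Proof. by move=> mf; apply/measurable_EFinP; mfun. Qed.

Lemma sqnorm_fin_num f : sqint f -> sqnorm f \is a fin_num.
Proof. by move=> [_ fy]; rewrite ge0_fin_numE// sqnorm_ge0. Qed.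

Lemma ge0_fin_le_lty (a : \bar R) (M : R) : (a <= M%:E)%E -> (a < +oo)%E.
Proof. by move=> aM; rewrite (le_lt_trans aM)// ltry. Qed.

Lemma le_sqnorm f g : measurable_fun setT f -> measurable_fun setT g ->
  (forall x, `|f x| <= `|g x|) -> (sqnorm f <= sqnorm g)%E.
Proof.
move=> mf mg fg; apply: ge0_le_integral => //; try exact: measurable_fun_sqr_EFin.
  by move=> x _; rewrite lee_fin sqr_ge0.
move=> x _; rewrite lee_fin -[f x ^+ 2]real_normK ?num_real//.
by rewrite -[g x ^+ 2]real_normK ?num_real// lerXn2r// nnegrE.
Qed.

Lemma sqnormZ c f : measurable_fun setT f ->
  sqnorm (fun x => c * f x) = ((c ^+ 2)%:E * sqnorm f)%E.
Proof.
move=> mf; rewrite /sqnorm -ge0_integralZl//.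
- by apply: eq_integral => x _; rewrite -EFinM exprMn.
- exact: measurable_fun_sqr_EFin.
- by move=> x _; rewrite lee_fin sqr_ge0.
- by rewrite lee_fin sqr_ge0.
Qed.

Lemma sqnormN f : sqnorm (fun x => - f x) = sqnorm f.
Proof. by apply: eq_integral => x _; rewrite sqrrN. Qed.

Lemma sqnorm_distC f g : sqnorm (fun x => f x - g x) = sqnorm (fun x => g x - f x).
Proof. by apply: eq_integral => x _; rewrite -sqrrN opprB. Qed.

(** A substitute for the triangle inequality that avoids square roots; the constant
    does not matter because it is only used to pass to limits. *)
Lemma le_sqnormD f g : measurable_fun setT f -> measurable_fun setT g ->
  (sqnorm (fun x => f x + g x)%R <= 2%:E * (sqnorm f + sqnorm g))%E.
Proof.
move=> mf mg; rewrite /sqnorm -ge0_integralD//; last 4 first.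
  by move=> x _; rewrite lee_fin sqr_ge0.
  exact: measurable_fun_sqr_EFin.
  by move=> x _; rewrite lee_fin sqr_ge0.
  exact: measurable_fun_sqr_EFin.
rewrite -ge0_integralZl//.
- apply: ge0_le_integral => //.
  + by move=> x _; rewrite lee_fin sqr_ge0.
  + by apply: measurable_fun_sqr_EFin; mfun.
  + by apply/measurable_EFinP; mfun.
  + move=> x _; rewrite -EFinD -EFinM lee_fin.
    by have := sqr_ge0 (f x - g x); nra.
- by apply/measurable_EFinP; mfun.
- by move=> x _; rewrite -EFinD lee_fin addr_ge0 ?sqr_ge0.
Qed.

Lemma sqintZ c f : sqint f -> sqint (fun x => c * f x).
Proof.
move=> [mf fy]; split; first by mfun.
by rewrite sqnormZ// -(fineK (sqnorm_fin_num (conj mf fy))) -EFinM ltry.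
Qed.

Lemma sqintN f : sqint f -> sqint (fun x => - f x).
Proof. by move=> [mf fy]; split; [mfun|rewrite sqnormN]. Qed.

Lemma sqintD f g : sqint f -> sqint g -> sqint (fun x => f x + g x).
Proof.
move=> [mf fy] [mg gy]; split; first by mfun.
apply: le_lt_trans (le_sqnormD mf mg) _.
rewrite -(fineK (sqnorm_fin_num (conj mf fy))) -(fineK (sqnorm_fin_num (conj mg gy))).
by rewrite -EFinD -EFinM ltry.
Qed.

Lemma sqintB f g : sqint f -> sqint g -> sqint (fun x => f x - g x).
Proof. by move=> sf sg; apply: sqintD => //; exact: sqintN. Qed.

Lemma le_sqint f g : measurable_fun setT f -> (forall x, `|f x| <= `|g x|) ->
  sqint g -> sqint f.
Proof. by move=> mf fg [mg gy]; split => //; apply: le_lt_trans gy; exact: le_sqnorm. Qed.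

Lemma sqint_reflect f c : sqint f -> sqint (fun x => f (c - x)).
Proof.
move=> [mf fy]; split; first by apply: (measurableT_comp mf); mfun.
rewrite /sqnorm (ge0_integral_reflect c (f := fun x => (f x ^+ 2)%:E))//.
- exact: measurable_fun_sqr_EFin.
- by move=> x; rewrite lee_fin sqr_ge0.
Qed.

Lemma sqnorm_reflect f : measurable_fun setT f -> sqnorm (fun x => f (- x)) = sqnorm f.
Proof.
move=> mf; rewrite /sqnorm -[RHS](ge0_integral_reflect 0).
- by apply: eq_integral => x _; rewrite sub0r.
- exact: measurable_fun_sqr_EFin.
- by move=> x; rewrite lee_fin sqr_ge0.
Qed.

Lemma sqint_integrable_sqr f : sqint f -> integrableR (fun x => f x ^+ 2).
Proof.
move=> [mf fy]; apply/integrableP; split; first exact: measurable_fun_sqr_EFin.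
by under eq_integral do rewrite /= ger0_norm ?sqr_ge0//.
Qed.

Lemma le_integrableR f g : measurable_fun setT f -> (forall x, `|f x| <= g x) ->
  integrableR g -> integrableR f.
Proof.
move=> mf fg ig; apply: le_integrable ig => //; first exact/measurable_EFinP.
by move=> x _ /=; rewrite lee_fin (le_trans (fg x))// ler_norm.
Qed.

Lemma integrableR_measurable f : integrableR f -> measurable_fun setT f.
Proof. by move=> /measurable_int/measurable_EFinP. Qed.

Lemma integrableRD f g : integrableR f -> integrableR g ->
  integrableR (fun x => f x + g x).
Proof. exact: integrableD. Qed.

Lemma integrableRB f g : integrableR f -> integrableR g ->
  integrableR (fun x => f x - g x).
Proof. exact: integrableB. Qed.

Lemma integrableRZ c f : integrableR f -> integrableR (fun x => c * f x).
Proof. exact: integrableZl. Qed.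

Lemma integrableRZr c f : integrableR f -> integrableR (fun x => f x * c).
Proof.
by move=> /(integrableRZ c); apply: eq_integrable => // x _ /=; rewrite mulrC.
Qed.

Lemma integrableR_norm f : integrableR f -> integrableR (fun x => `|f x|).
Proof. exact: integrable_norm. Qed.

Lemma EFin_Rintegral f : integrableR f -> (\int[mu]_x f x)%:E = (\int[mu]_x (f x)%:E)%E.
Proof. by move=> fi; rewrite /Rintegral fineK//; exact: integrable_fin_num. Qed.

Lemma sqint_integrableM f g : sqint f -> sqint g -> integrableR (fun x => f x * g x).
Proof.
move=> sf sg; have [mf _] := sf; have [mg _] := sg.
apply: (le_integrableR (g := fun x => f x ^+ 2 + g x ^+ 2)); first by mfun.
  move=> x; rewrite ler_norml; apply/andP; split.
  - by have := sqr_ge0 (f x + g x); have := sqr_ge0 (f x); have := sqr_ge0 (g x); nra.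
  - by have := sqr_ge0 (f x - g x); have := sqr_ge0 (f x); have := sqr_ge0 (g x); nra.
by apply: integrableRD; exact: sqint_integrable_sqr.
Qed.

Lemma EFin_sqnorm f : sqint f -> sqnorm f = (\int[mu]_x (f x ^+ 2))%:E.
Proof. by move=> sf; rewrite EFin_Rintegral//; exact: sqint_integrable_sqr. Qed.

Lemma sqnorm_eq0 f : measurable_fun setT f -> sqnorm f = 0%E ->
  {ae mu, forall x, f x = 0}.
Proof.
move=> mf f0.
have := @ae_eq_integral_abs _ _ _ mu setT measurableT (fun x => (f x ^+ 2)%:E)
  (measurable_fun_sqr_EFin mf).
under eq_integral do rewrite /= ger0_norm ?sqr_ge0//.
move=> -[/(_ f0) h _]; apply: aeS h => x /(_ I) /= [/eqP].
by rewrite sqrf_eq0 => /eqP.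
Qed.

Lemma eq_ae_sqnorm f g : measurable_fun setT f -> measurable_fun setT g ->
  {ae mu, forall x, f x = g x} -> sqnorm f = sqnorm g.
Proof.
move=> mf mg fg; apply: ge0_ae_eq_integral => //; try exact: measurable_fun_sqr_EFin;
  try by (move=> x _; rewrite lee_fin sqr_ge0).
by apply: aeS fg => x ->.
Qed.

(** The quadratic form [s, t |-> \int (s f + t g)^2] is nonnegative, hence its
    discriminant is nonpositive. *)
Lemma Cauchy_Schwarz f g : sqint f -> sqint g ->
  (\int[mu]_x (f x * g x)) ^+ 2 <= (\int[mu]_x (f x ^+ 2)) * (\int[mu]_x (g x ^+ 2)).
Proof.
move=> sf sg.
set b := \int[mu]_x (f x * g x); set a := \int[mu]_x (f x ^+ 2).
set c := \int[mu]_x (g x ^+ 2).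
have a0 : 0 <= a by apply: Rintegral_ge0 => x _; rewrite sqr_ge0.
have c0 : 0 <= c by apply: Rintegral_ge0 => x _; rewrite sqr_ge0.
have q (s t : R) : 0 <= s ^+ 2 * a + 2 * s * t * b + t ^+ 2 * c.
  rewrite (_ : _ + _ + _ = \int[mu]_x ((s * f x + t * g x) ^+ 2)).
    by apply: Rintegral_ge0 => x _; rewrite sqr_ge0.
  have if2 := sqint_integrable_sqr sf; have ig2 := sqint_integrable_sqr sg.
  have ifg := sqint_integrableM sf sg.
  rewrite /a /b /c -!RintegralZl// -!RintegralD//; try exact: integrableRZ.
    by apply: eq_Rintegral => x _; ring.
  by apply: integrableRD; exact: integrableRZ.
have [a00|a0'] := eqVneq a 0.
  have [->|b0] := eqVneq b 0; first by rewrite expr0n/= mulr_ge0.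
  (* For [a = 0] the form is affine in [s]; this [s] makes it equal to [- 1]. *)
  have := q (- (c + 1) / (2 * b)) 1; rewrite a00.
  rewrite (_ : _ + _ + _ = - 1); last by field.
  by rewrite lerNr oppr0 ler10.
(* The minimiser of the quadratic form, up to scaling. *)
have := q (- b) a.
rewrite (_ : _ + _ + _ = a * (a * c - b ^+ 2)); last by ring.
by rewrite pmulr_rge0 ?subr_ge0// lt0r a0' a0.
Qed.

(** Convergence in quadratic mean implies weak convergence. *)
Lemma cvg_RintegralM {I : Type} {F : set_system I} {FF : Filter F}
    (u : I -> R -> R) g : (forall i, sqint (u i)) -> sqint g ->
  sqnorm (u i) @[i --> F] --> 0%E ->
  \int[mu]_x (u i x * g x) @[i --> F] --> (0 : R).
Proof.
move=> su sg u0.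
have {}u0 : (\int[mu]_x (u i x ^+ 2)) @[i --> F] --> (0 : R).
  move: u0; under eq_fun do rewrite EFin_sqnorm//.
  by move/fine_cvg.
apply/cvgr0Pnorm_le => e e0.
set c := \int[mu]_x (g x ^+ 2).
have c0 : 0 <= c by apply: Rintegral_ge0 => x _; rewrite sqr_ge0.
have d0 : 0 < e ^+ 2 / (c + 1) by rewrite divr_gt0 ?exprn_gt0//; lra.
move/cvgr0Pnorm_le : u0 => /(_ _ d0); apply: filterS => i.
rewrite ger0_norm; last by apply: Rintegral_ge0 => x _; rewrite sqr_ge0.
move=> ui; rewrite -ler_sqr ?nnegrE//; last exact: ltW.
rewrite real_normK ?num_real//; apply: le_trans (Cauchy_Schwarz (su i) sg) _.
rewrite -/c; apply: (@le_trans _ _ (e ^+ 2 / (c + 1) * c)); first exact: ler_wpM2r.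
by rewrite -mulrA ler_piMr ?sqr_ge0// mulrC ler_pdivrMr; lra.
Qed.

End square_integrable.
Notation integrableR f := ((@lebesgue_measure _).-integrable setT (EFin \o f%R)).

(** * Limits in quadratic mean *)

Section L2_limits.
Context {R : realType}.
Notation mu := (@lebesgue_measure R).
Implicit Types (f g h : R -> R) (u : nat -> R -> R).

(** Lower semicontinuity of the energy under convergence almost everywhere: this is
    how inequalities pass to limits throughout. *)
Lemma sqnorm_fatou u (v : R -> R) (M : \bar R) : (forall k, measurable_fun setT (u k)) ->
  measurable_fun setT v -> {ae mu, forall x, u k x @[k --> \oo] --> v x} ->
  (\forall k \near \oo, sqnorm (u k) <= M)%E -> (sqnorm v <= M)%E.
Proof.
move=> mu_ mv uv [N _ uM].
pose f k x := ((u (k + N)%N x) ^+ 2)%:E.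
have mf k : measurable_fun setT (f k) by exact: measurable_fun_sqr_EFin.
have f0 k x : setT x -> (0 <= f k x)%E by move=> _; rewrite lee_fin sqr_ge0.
apply: (@le_trans _ _ (\int[mu]_x limn_einf (f ^~ x))%E); last first.
  apply: le_trans (fatou mu measurableT mf f0) _.
  rewrite limn_einf_lim; apply: lime_le; first exact: is_cvg_einfs.
  apply: nearW => n; apply: (@le_trans _ _ (sqnorm (u (n + N)%N))).
    by apply: ereal_inf_lbound; exists n => //=.
  by apply: uM; rewrite /= leq_addl.
apply: ae_ge0_le_integral => //.
- by move=> x _; rewrite lee_fin sqr_ge0.
- exact: measurable_fun_sqr_EFin.
- move=> x _; rewrite limn_einf_lim; apply: lime_ge; first exact: is_cvg_einfs.
  apply: nearW => n; apply: le_ereal_inf_tmp => _ [m _ <-]; exact: f0.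
- rewrite (_ : (fun x => _) = fun x => - limn_esup (fun k => - f k x))%E//.
  apply: measurableT_comp => //; apply: measurable_fun_limn_esup => k.
  exact: (measurableT_comp (f := -%E) _ (mf k)).
- apply: aeS uv => x ux _; rewrite (_ : limn_einf _ = (v x ^+ 2)%:E)//.
  apply: (cvg_limn_einf_sup _).1; apply: cvg_EFin; first exact: nearW.
  rewrite /f (_ : fine \o _ = (fun k => u (k + N)%N x ^+ 2))//.
  rewrite (@cvg_shiftn N _ (fun k => u k x ^+ 2)).
  by rewrite expr2; under eq_fun do rewrite expr2; exact: cvgM.
Qed.

(** The core of the completeness of the space of square-integrable functions.  The
    weights [4 ^ k] are still summable against the bound [C / 8 ^ k], so
    [\sum_k 4 ^ k |u (k + 1) - u k|^2] is finite almost everywhere; where it is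
    finite, the increments decay like [2 ^ - k] and the sequence converges. *)
Lemma L2_fast_cauchy_cvg u (C : R) : (forall k, measurable_fun setT (u k)) ->
  (forall k, sqnorm (fun x => u k.+1 x - u k x)%R <= (C / 8 ^+ k)%:E)%E ->
  exists2 v : R -> R, measurable_fun setT v & {ae mu, forall x, u k x @[k --> \oo] --> v x}.
Proof.
move=> mu_ uC.
pose d k x := u k.+1 x - u k x.
pose S x := (\sum_(k <oo) (4 ^+ k * d k x ^+ 2)%:E)%E.
have C0 : 0 <= C.
  have := uC 0%N; rewrite expr0 divr1 -lee_fin; apply: le_trans.
  exact: sqnorm_ge0.
have md k : measurable_fun setT (d k) by rewrite /d; mfun.
have mS k : measurable_fun setT (fun x => (4 ^+ k * d k x ^+ 2)%:E).
  by apply/measurable_EFinP; mfun.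
have S0 k x : (0 <= (4 ^+ k * d k x ^+ 2)%:E)%E.
  by rewrite lee_fin mulr_ge0 ?sqr_ge0.
have iS : (\int[mu]_x S x <= (2 * C)%:E)%E.
  rewrite /S integral_nneseries//; apply: lime_le.
    by apply: is_cvg_nneseries => n _ _; apply: integral_ge0.
  apply: nearW => n.
  apply: (@le_trans _ _ (\sum_(0 <= k < n) (C * 2^-1 ^+ k)%:E)%E).
    apply: lee_sum => k _; under eq_integral do rewrite EFinM.
    rewrite ge0_integralZl//; last 2 first.
    - exact: measurable_fun_sqr_EFin.
    - by move=> x _; rewrite lee_fin sqr_ge0.
    apply: (@le_trans _ _ ((4 ^+ k)%:E * (C / 8 ^+ k)%:E)%E).
      by apply: lee_wpmul2l; [rewrite lee_fin|exact: uC].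
    rewrite -EFinM lee_fin mulrCA ler_wpM2l// (_ : 8 = 4 * 2 :> R); last by ring.
    by rewrite exprMn invfM mulrA mulfV ?gt_eqF ?exprn_gt0// mul1r exprVn.
  rewrite sumEFin lee_fin -mulr_sumr mulrC ler_wpM2r//.
  have := @geometric_le_lim R n 1 2^-1; rewrite /series/geometric/=.
  under eq_bigr do rewrite mul1r.
  move=> /(_ ler01); rewrite mul1r (_ : (1 - 2^-1)^-1 = 2 :> R); last by field.
  apply; first by [].
  by rewrite ger0_norm// invf_lt1// ltr1n.
have iSi : mu.-integrable setT S.
  apply/integrableP; split.
    apply: (emeasurable_fun_cvg (fun n x => \sum_(0 <= k < n) (4 ^+ k * d k x ^+ 2)%:E)%E).
      by move=> n; apply: emeasurable_sum => k.
    by move=> x _; apply: is_cvg_nneseries.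
  under eq_integral do rewrite gee0_abs ?nneseries_ge0//.
  exact: ge0_fin_le_lty iS.
have cvgu x : S x \is a fin_num -> cvgn (fun k => u k x).
  move=> Sx.
  have db k : `|d k x| <= (fine (S x) + 1) * 2^-1 ^+ k.
    have s0 : 0 <= fine (S x) by apply: fine_ge0; exact: nneseries_ge0.
    have : (4 ^+ k * d k x ^+ 2) <= fine (S x).
      rewrite -lee_fin fineK//.
      have := @nneseries_lim_ge R (fun k => (4 ^+ k * d k x ^+ 2)%:E) xpredT 0%N k.+1.
      move=> /(_ (fun i _ _ => S0 i x)); apply: le_trans.
      by rewrite big_nat_recr//= leeDr// sume_ge0.
    rewrite exprVn ler_pdivlMr ?exprn_gt0// => h.
    rewrite -ler_sqr ?nnegrE ?mulr_ge0 ?addr_ge0// exprMn real_normK ?num_real// -exprM.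
    rewrite (mulnC k) exprM (_ : 2 ^+ 2 = 4 :> R); last by ring.
    by rewrite mulrC; apply: le_trans h _; nra.
  have : cvgn (series (fun k => d k x)).
    apply: normed_cvg; apply: (@series_le_cvg _ _ (geometric (fine (S x) + 1) 2^-1)) => //.
    - by move=> k; rewrite normr_ge0.
    - by move=> k; rewrite mulr_ge0 ?exprn_ge0// addr_ge0// fine_ge0// nneseries_ge0.
    - by apply: is_cvg_geometric_series; rewrite ger0_norm// invf_lt1// ltr1n.
  rewrite (_ : series _ = (fun k => u k x - u 0%N x)); last first.
    apply/funext => n; have := telescopeK (fun k => u k x).
    by move=> /(congr1 (fun w : nat -> R => w n)).
  move=> c; rewrite (_ : (fun k => u k x) = (fun k => (u k x - u 0%N x) + u 0%N x)).
    by apply: is_cvgD => //; exact: is_cvg_cst.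
  by apply/funext => k; rewrite subrK.
exists (fun x => fine (limn_esup (fun k => (u k x)%:E))).
  apply: (measurableT_comp (f := fine)) => //.
  by apply: measurable_fun_limn_esup => k; exact/measurable_EFinP.
have := integrable_ae measurableT iSi; apply: aeS => x /(_ I) /cvgu ux.
have uxE : (u k x)%:E @[k --> \oo] --> (limn (fun k => u k x))%:E.
  by apply: cvg_EFin => //; exact: nearW.
by rewrite (cvg_limn_einf_sup uxE).2.
Qed.

Definition trunc (A : R) f x := f x * \1_(`[- A, A]) x.

Lemma measurable_trunc A f : measurable_fun setT f -> measurable_fun setT (trunc A f).
Proof. by move=> mf; apply: measurable_funM => //. Qed.

Lemma norm_trunc_le A f x : `|trunc A f x| <= `|f x|.
Proof. by rewrite /trunc indicE normrM ler_piMr// ger0_norm// lern1 leq_b1. Qed.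

Lemma sqint_trunc A f : sqint f -> sqint (trunc A f).
Proof.
move=> sf; apply: le_sqint (sf); last exact: norm_trunc_le.
by apply: measurable_trunc; case: sf.
Qed.

Lemma sqint_indic_itv (a b : R) : sqint (\1_(`[a, b]) : R -> R).
Proof.
split => //; rewrite /sqnorm.
under eq_integral => x _.
  rewrite (_ : _ ^+ 2 = \1_(`[a, b]) x); first over.
  by rewrite indicE; case: (_ \in _); rewrite ?expr1n ?expr0n.
rewrite integral_indic//= setIT lebesgue_measure_itv/=.
by case: ifP => _; rewrite ?ltry// -EFinB ltry.
Qed.

Lemma integrable_trunc A f : sqint f -> integrableR (trunc A f).
Proof. by move=> sf; apply: sqint_integrableM => //; exact: sqint_indic_itv. Qed.

Lemma cvg_trunc A_ f x : A_ n @[n --> \oo] --> +oo ->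
  \forall n \near \oo, trunc (A_ n) f x = f x.
Proof.
move=> /cvgryPge /(_ `|x|); apply: filterS => n An.
by rewrite /trunc indicE mem_set ?mulr1//= in_itv/= -ler_norml.
Qed.

Lemma cvg_sqnorm_trunc f : sqint f ->
  sqnorm (fun x => f x - trunc A f x) @[A --> +oo] --> 0%E.
Proof.
move=> sf; have [mf _] := sf; apply/cvge_pinftyP => A_ Ay.
rewrite -(@integral0 _ _ _ mu setT).
pose g n x := ((f x - trunc (A_ n) f x) ^+ 2)%:E.
have mg n : measurable_fun setT (g n).
  by apply: measurable_fun_sqr_EFin; apply: measurable_funB => //; exact: measurable_trunc.
have gle n x : (`|g n x| <= (f x ^+ 2)%:E)%E.
  rewrite /= lee_fin ger0_norm ?sqr_ge0// /trunc indicE.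
  by case: (_ \in _); rewrite ?mulr1 ?mulr0 ?subrr ?subr0 ?expr0n ?sqr_ge0.
have gcvg : {ae mu, forall x, setT x -> g n x @[n --> \oo] --> cst 0%E x}.
  apply: aeW => x _; apply: cvg_near_cst; have := cvg_trunc f x Ay.
  by apply: filterS => n; rewrite /g => ->; rewrite subrr expr0n.
have gdom : {ae mu, forall x n, setT x -> (`|g n x| <= (f x ^+ 2)%:E)%E}.
  by apply: aeW => x n _.
by have [] := @dominated_convergence _ _ _ mu setT measurableT g (cst 0%E) _
  mg (measurable_cst _) gcvg (sqint_integrable_sqr sf) gdom.
Qed.

End L2_limits.

(** * The Hartley transform of an integrable function *)

Section hartley_L1.
Context {R : realType}.
Notation mu := (@lebesgue_measure R).
Implicit Types (f g h : R -> R).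

(** No integrability is required: the integral is by definition the difference of
    the integrals of the positive and negative parts, each of which is measurable by
    Tonelli's theorem. *)
Lemma measurable_Rintegral_param (g : R * R -> R) : measurable_fun setT g ->
  measurable_fun setT (fun x => \int[mu]_y g (x, y)).
Proof.
move=> mg; rewrite /Rintegral; apply: (measurableT_comp (f := fine)) => //.
have mG : measurable_fun setT (EFin \o g) by exact/measurable_EFinP.
rewrite (_ : (fun x => _) = fun x => \int[mu]_y ((EFin \o g)^\+ (x, y)) -
    \int[mu]_y ((EFin \o g)^\- (x, y)))%E.
  apply: emeasurable_funB.
  - apply: (measurable_fun_fubini_tonelli_F (m2 := mu) ((EFin \o g)^\+)%E) => //.
    exact: measurable_funepos.
  - apply: (measurable_fun_fubini_tonelli_F (m2 := mu) ((EFin \o g)^\-)%E) => //.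
    exact: measurable_funeneg.
by apply/funext => x; rewrite integralE; congr (_ - _)%E; apply: eq_integral => y _;
  rewrite ?funeposE ?funenegE.
Qed.

Lemma Rintegral_Fubini (g : R * R -> R) : measurable_fun setT g ->
  (\int[mu]_x \int[mu]_y `|(g (x, y))%:E| < +oo)%E ->
  (forall x, integrableR (fun y => g (x, y))) ->
  (forall y, integrableR (fun x => g (x, y))) ->
  \int[mu]_x (\int[mu]_y g (x, y)) = \int[mu]_y (\int[mu]_x g (x, y)).
Proof.
move=> mg gy g1 g2.
have mG : measurable_fun setT (EFin \o g) by exact/measurable_EFinP.
have gi : (mu \x mu)%E.-integrable setT (EFin \o g) by exact/integrable12ltyP.
rewrite {1}/Rintegral {2}/Rintegral; congr fine.
under eq_integral do rewrite EFin_Rintegral//.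
under [RHS]eq_integral do rewrite EFin_Rintegral//.
exact: (Fubini gi).
Qed.

(** The Hartley transform, a real transform that is equivalent to the Fourier
    transform on real functions. *)
Definition hart f (w : R) : R := \int[mu]_t (f t * cas (w * t)).

Lemma norm_cas_le (x : R) : `|cas x| <= 2.
Proof.
rewrite /cas; apply: le_trans (ler_normD _ _) _.
have c1 : `|cos x| <= 1 by rewrite ler_norml cos_geN1 cos_le1.
have s1 : `|sin x| <= 1 by rewrite ler_norml sin_geN1 sin_le1.
lra.
Qed.

Lemma integrable_hart f w : integrableR f -> integrableR (fun t => f t * cas (w * t)).
Proof.
move=> fi; have mf := integrableR_measurable fi.
apply: (le_integrableR (g := fun t => 2 * `|f t|)); first by mfun.
  by move=> t; rewrite normrM mulrC ler_wpM2r// norm_cas_le.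
by apply: integrableRZ; exact: integrableR_norm.
Qed.

Lemma norm_hart_le f w : integrableR f -> `|hart f w| <= 2 * \int[mu]_t `|f t|.
Proof.
move=> fi; apply: le_trans (le_normr_Rintegral _ (integrable_hart w fi)) _ => //.
rewrite -RintegralZl//; last exact: integrableR_norm.
apply: le_Rintegral => //.
- by apply: integrableR_norm; exact: integrable_hart.
- by apply: integrableRZ; exact: integrableR_norm.
- by move=> t _; rewrite normrM mulrC ler_wpM2r// norm_cas_le.
Qed.

Lemma measurable_hart f : measurable_fun setT f -> measurable_fun setT (hart f).
Proof.
move=> mf; rewrite /hart.
apply: (measurable_Rintegral_param (g := fun z => f z.2 * cas (z.1 * z.2))).
by mfun; apply: (measurableT_comp mf); mfun.
Qed.

Lemma hartD f g w : integrableR f -> integrableR g ->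
  hart (fun t => f t + g t) w = hart f w + hart g w.
Proof.
move=> fi gi; rewrite /hart -RintegralD//; try exact: integrable_hart.
by apply: eq_Rintegral => t _; rewrite mulrDl.
Qed.

Lemma hartZ c f w : integrableR f -> hart (fun t => c * f t) w = c * hart f w.
Proof.
move=> fi; rewrite /hart -RintegralZl//; try exact: integrable_hart.
by apply: eq_Rintegral => t _; rewrite mulrA.
Qed.

Lemma hartB f g w : integrableR f -> integrableR g ->
  hart (fun t => f t - g t) w = hart f w - hart g w.
Proof.
move=> fi gi; rewrite /hart -RintegralB//; try exact: integrable_hart.
by apply: eq_Rintegral => t _; rewrite mulrBl.
Qed.

Lemma integrable_hartM f g : integrableR f -> integrableR g ->
  integrableR (fun t => hart f t * g t).
Proof.
move=> fi gi; have mf := integrableR_measurable fi.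
have mg := integrableR_measurable gi.
have mh := measurable_hart mf.
apply: (le_integrableR (g := fun t => (2 * \int[mu]_t `|f t|) * `|g t|)); first by mfun.
  by move=> t; rewrite normrM ler_wpM2r// norm_hart_le.
by apply: integrableRZ; exact: integrableR_norm.
Qed.

(** The multiplication formula: the kernel [cas (w * t)] is symmetric in [w] and
    [t], so Fubini's theorem moves the transform from one factor to the other. *)
Lemma Rintegral_hartM f g : integrableR f -> integrableR g ->
  \int[mu]_w (hart f w * g w) = \int[mu]_t (f t * hart g t).
Proof.
move=> fi gi; have mf := integrableR_measurable fi.
have mg := integrableR_measurable gi.
pose k (z : R * R) := f z.1 * g z.2 * cas (z.1 * z.2).
transitivity (\int[mu]_w \int[mu]_t k (t, w)).
  apply: eq_Rintegral => w _; rewrite /hart mulrC -RintegralZl//; last exact: integrable_hart.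
  by apply: eq_Rintegral => t _; rewrite /k/= (mulrC w); ring.
transitivity (\int[mu]_t \int[mu]_w k (t, w)); last first.
  apply: eq_Rintegral => w _; rewrite /hart -RintegralZl//; last exact: integrable_hart.
  by apply: eq_Rintegral => t _; rewrite /k/=; ring.
have k1 x : integrableR (fun y => k (x, y)).
  rewrite /k/=.
  have := integrableRZ (f x) (integrable_hart x gi).
  by apply: eq_integrable => // y _ /=; rewrite mulrA.
have k2 y : integrableR (fun x => k (x, y)).
  rewrite /k/=.
  have := integrableRZ (g y) (integrable_hart y fi).
  by apply: eq_integrable => // x _ /=; rewrite (mulrC y); congr EFin; ring.
apply/esym/Rintegral_Fubini => //.
  rewrite /k; mfun; first by apply: (measurableT_comp mf); mfun.
  by apply: (measurableT_comp mg); mfun.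
apply: (@le_lt_trans _ _ (\int[mu]_x (`|f x| * (2 * \int[mu]_y `|g y|))%:E)%E); last first.
  rewrite -EFin_Rintegral ?ltry//.
  by apply: integrableRZr; exact: integrableR_norm.
apply: ge0_le_integral => //.
- move=> x _; exact: integral_ge0.
- have mk : measurable_fun setT (fun z => `|k z|%:E).
    apply/measurable_EFinP; rewrite /k; mfun.
      by apply: (measurableT_comp mf); mfun.
    by apply: (measurableT_comp mg); mfun.
  exact: (measurable_fun_fubini_tonelli_F (m2 := mu) (fun z => `|k z|%:E) mk).
- by apply/measurable_EFinP; mfun.
- move=> x _; rewrite (_ : (fun y => _) = EFin \o (fun y => `|k (x, y)|)) //.
  rewrite -EFin_Rintegral; last exact: integrableR_norm.
  have ig := integrableR_norm gi.
  rewrite lee_fin mulrA -RintegralZl//.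
  apply: le_Rintegral => //; first exact: integrableR_norm.
    exact: integrableRZ.
  move=> y _; rewrite /k/= !normrM -!mulrA ler_wpM2l// mulrC ler_wpM2r//.
  exact: norm_cas_le.
Qed.

End hartley_L1.

(** * Exponential integrals on a half-line *)

Section half_line_integrals.
Context {R : realType}.
Notation mu := (@lebesgue_measure R).
Implicit Types (f g h F : R -> R).

Lemma derivable_continuous f : (forall x, derivable f x 1) -> continuous f.
Proof.
by move=> df x; apply: differentiable_continuous; exact/derivable1_diffP.
Qed.

(** A form of the fundamental theorem whose hypotheses can be discharged by the
    automatic computation of derivatives. *)
Lemma FTC_pinfty f F (a l : R) : (forall x : R, is_derive x 1 F (f x)) ->
  continuous f -> (forall x, a <= x -> 0 <= f x) -> F x @[x --> +oo] --> l ->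
  (\int[mu]_(x in `[a, +oo[) (f x)%:E = (l - F a)%:E)%E.
Proof.
move=> dF cf f0 Fl.
have cF : continuous F by apply: derivable_continuous => x; exact: ex_derive.
rewrite (@ge0_continuous_FTC2y _ f F a l) ?EFinB//.
- exact: continuous_subspaceT.
- by apply: cvg_at_right_filter; exact: cF.
- by move=> x _; rewrite derive1E; exact: derive_val.
Qed.

Lemma Rintegral_reflect c f : measurable_fun setT f ->
  \int[mu]_x f (c - x) = \int[mu]_x f x.
Proof.
move=> mf; have mF : measurable_fun setT (EFin \o f) by exact/measurable_EFinP.
rewrite /Rintegral integralE [in RHS]integralE; congr (fine (_ - _)%E).
- rewrite -[RHS](ge0_integral_reflect c)//; last exact: (measurable_funepos mF).
  by apply: eq_integral => x _; rewrite !funeposE.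
- rewrite -[RHS](ge0_integral_reflect c)//; last exact: (measurable_funeneg mF).
  by apply: eq_integral => x _; rewrite !funenegE.
Qed.

Lemma integrableR_reflect c f : integrableR f -> integrableR (fun x => f (c - x)).
Proof.
move=> fi; have mf := integrableR_measurable fi; move/integrableP : (fi) => [_ fy].
apply/integrableP; split.
  by apply/measurable_EFinP/(measurableT_comp mf); mfun.
rewrite (ge0_integral_reflect c (f := fun x => `|(f x)%:E|%E))//.
by apply: measurableT_comp => //; exact/measurable_EFinP.
Qed.

Lemma Rintegral_halves f : integrableR f ->
  \int[mu]_x f x = \int[mu]_(x in `[0, +oo[) (f x + f (- x)).
Proof.
move=> fi; have mf := integrableR_measurable fi.
have fNi : integrableR (fun x => f (- x)).
  by have := integrableR_reflect 0 fi; apply: eq_integrable => // x _ /=; rewrite sub0r.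
have mI : measurable (`[0%R, +oo[ : set (measurableTypeR R)) by exact: measurable_itv.
rewrite RintegralD//; last 2 first.
- exact: integrableS fi.
- exact: integrableS fNi.
rewrite -(setUv `[0, +oo[) Rintegral_setU//; last 3 first.
- exact: measurableC.
- by rewrite setUv.
- by rewrite disj_set2E setICr.
congr (_ + _); rewrite setCitvr.
rewrite -Rintegral_itv_obnd_cbnd; last first.
  exact: integrableS fNi.
rewrite Rintegral_mkcond [RHS]Rintegral_mkcond -[LHS](Rintegral_reflect 0).
  apply: eq_Rintegral => x _; rewrite sub0r /patch.
  congr (if _ then _ else _); apply/idP/idP; rewrite !inE/= !in_itv/= andbT; lra.
by apply/(measurable_restrictT f); [exact: measurable_itv|exact: measurable_funTS].
Qed.

Section exponential_integrals.
Context (e : R).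
Context (e0 : 0 < e).

Lemma cvg_expR_scale : expR (- (e * x)) @[x --> +oo] --> (0 : R).
Proof.
apply: (cvg_comp (fun x => e * x) (fun x => expR (- x)) _ (@cvgr_expR R)).
by apply: gt0_cvgMry => //; exact: cvg_id.
Qed.

(** The primitive is [expR (- e x) * B x], which vanishes at infinity as soon as
    [B] is bounded. *)
Lemma integral_expR_bounded (g B dB : R -> R) (M : R) :
  (forall x : R, is_derive x 1 B (dB x)) -> (forall x, `|B x| <= M) ->
  (forall x, g x = dB x - e * B x) -> (forall x, 0 <= g x) -> continuous g ->
  (\int[mu]_(x in `[0%R, +oo[) (expR (- (e * x)) * g x)%:E = (- B 0)%:E)%E.
Proof.
move=> dBE BM gE g0 cg.
apply: etrans; [apply: (@FTC_pinfty _ (fun x => expR (- (e * x)) * B x) 0 0)|].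
- move=> x; apply: is_derive_eq; rewrite gE /GRing.scale/=; ring.
- move=> x; apply: cvgM; last exact: cg.
  apply: (derivable_continuous (f := fun x => expR (- (e * x)))) => y.
  exact: ex_derive.
- by move=> x _; rewrite mulr_ge0// expR_ge0.
- have M0 : 0 <= M by apply: le_trans (BM 0).
  apply/cvgr0Pnorm_le => d d0.
  have d1 : 0 < d / (M + 1) by rewrite divr_gt0//; lra.
  have /cvgr0Pnorm_le /(_ _ d1) := cvg_expR_scale.
  apply: filterS => x; rewrite normrM => h.
  apply: (@le_trans _ _ (d / (M + 1) * M)); first by rewrite ler_pM.
  by rewrite mulrAC ler_pdivrMr; nra.
- by rewrite /= mulr0 oppr0 expR0 mul1r sub0r.
Qed.

Lemma integral_expR : (\int[mu]_(x in `[0%R, +oo[) (expR (- (e * x)))%:E = (e^-1)%:E)%E.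
Proof.
have := @integral_expR_bounded (cst 1) (cst (- e^-1)) (cst 0) (e^-1).
rewrite opprK => <-.
- by apply: eq_integral => x _; rewrite mulr1.
- by move=> x; rewrite normrN ger0_norm// invr_ge0 ltW.
- by move=> x; rewrite /cst mulrN opprK add0r mulfV ?gt_eqF.
- by move=> x.
- by move=> x; exact: cvg_cst.
Qed.

Let den_gt0 y : 0 < e ^+ 2 + y ^+ 2.
Proof. by rewrite ltr_wpDr ?sqr_ge0// exprn_gt0. Qed.

(** Adding [1] makes the integrand nonnegative, so that the fundamental theorem on
    a half-line applies without a domination argument. *)
Lemma integral_expR_1cos y :
  (\int[mu]_(x in `[0%R, +oo[) (expR (- (e * x)) * (1 + cos (y * x)))%:E =
   (e^-1 + e / (e ^+ 2 + y ^+ 2))%:E)%E.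
Proof.
have d0 := den_gt0 y; have d1 : e ^+ 2 + y ^+ 2 != 0 by rewrite gt_eqF.
have e1 : e != 0 by rewrite gt_eqF.
pose d := (e ^+ 2 + y ^+ 2)^-1.
apply: etrans; [apply: (@integral_expR_bounded _
  (fun x => - e^-1 + d * (y * sin (y * x) - e * cos (y * x)))
  (fun x => d * (y * (cos (y * x) * y) - e * (- sin (y * x) * y)))
  (e^-1 + d * (`|y| + e)))|].
- move=> x; apply: is_derive_eq; rewrite /GRing.scale/=; ring.
- move=> x; apply: le_trans (ler_normD _ _) _.
  have d2 : 0 <= d by rewrite invr_ge0 ltW.
  have e2 := ltW e0.
  rewrite normrN ger0_norm ?invr_ge0// lerD2l normrM (ger0_norm d2).
  rewrite ler_wpM2l//; apply: le_trans (ler_normB _ _) _; rewrite !normrM.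
  rewrite (gtr0_norm e0); apply: lerD.
    by rewrite ler_piMr// ler_norml sin_geN1 sin_le1.
  by rewrite ler_piMr// ler_norml cos_geN1 cos_le1.
- by move=> x; rewrite /d; field; rewrite d1 e1.
- by move=> x; have := cos_geN1 (y * x); lra.
- by apply: derivable_continuous => x; exact: ex_derive.
- by congr EFin; rewrite /= mulr0 sin0 cos0 /d; field; rewrite d1 e1.
Qed.

Lemma integral_expR_1sin y :
  (\int[mu]_(x in `[0%R, +oo[) (expR (- (e * x)) * (1 + sin (y * x)))%:E =
   (e^-1 + y / (e ^+ 2 + y ^+ 2))%:E)%E.
Proof.
have d0 := den_gt0 y; have d1 : e ^+ 2 + y ^+ 2 != 0 by rewrite gt_eqF.
have e1 : e != 0 by rewrite gt_eqF.
pose d := (e ^+ 2 + y ^+ 2)^-1.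
apply: etrans; [apply: (@integral_expR_bounded _
  (fun x => - e^-1 - d * (e * sin (y * x) + y * cos (y * x)))
  (fun x => - (d * (e * (cos (y * x) * y) + y * (- sin (y * x) * y))))
  (e^-1 + d * (e + `|y|)))|].
- move=> x; apply: is_derive_eq; rewrite /GRing.scale/=; ring.
- move=> x; apply: le_trans (ler_normB _ _) _.
  have d2 : 0 <= d by rewrite invr_ge0 ltW.
  have e2 := ltW e0.
  rewrite normrN ger0_norm ?invr_ge0// lerD2l normrM (ger0_norm d2).
  rewrite ler_wpM2l//; apply: le_trans (ler_normD _ _) _; rewrite !normrM.
  rewrite (gtr0_norm e0); apply: lerD.
    by rewrite ler_piMr// ler_norml sin_geN1 sin_le1.
  by rewrite ler_piMr// ler_norml cos_geN1 cos_le1.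
- by move=> x; rewrite /d; field; rewrite d1 e1.
- by move=> x; have := sin_geN1 (y * x); lra.
- by apply: derivable_continuous => x; exact: ex_derive.
- by congr EFin; rewrite /= mulr0 sin0 cos0 /d; field; rewrite d1 e1.
Qed.

Lemma ge0_integrable_half (f : R -> R) (r : R) : measurable_fun setT f -> (forall x, 0 <= f x) ->
  (\int[mu]_(x in `[0%R, +oo[) (f x)%:E = r%:E)%E ->
  mu.-integrable `[0, +oo[ (EFin \o f).
Proof.
move=> mf f0 fr; apply/integrableP; split.
  by apply/measurable_EFinP; exact: measurable_funTS.
by under eq_integral do rewrite /= ger0_norm//; rewrite fr ltry.
Qed.

Lemma Rintegral_expR_cos y :
  \int[mu]_(x in `[0%R, +oo[) (expR (- (e * x)) * cos (y * x)) = e / (e ^+ 2 + y ^+ 2).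
Proof.
transitivity (\int[mu]_(x in `[0%R, +oo[)
    (expR (- (e * x)) * (1 + cos (y * x)) - expR (- (e * x)))).
  by apply: eq_Rintegral => x _; ring.
rewrite RintegralB//.
- rewrite /Rintegral integral_expR_1cos integral_expR/=; ring.
- apply: ge0_integrable_half (integral_expR_1cos y); first by mfun.
  by move=> x; rewrite mulr_ge0 ?expR_ge0//; have := cos_geN1 (y * x); lra.
- by apply: ge0_integrable_half integral_expR; [mfun|move=> x; exact: expR_ge0].
Qed.

Lemma Rintegral_expR_sin y :
  \int[mu]_(x in `[0%R, +oo[) (expR (- (e * x)) * sin (y * x)) = y / (e ^+ 2 + y ^+ 2).
Proof.
transitivity (\int[mu]_(x in `[0%R, +oo[)
    (expR (- (e * x)) * (1 + sin (y * x)) - expR (- (e * x)))).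
  by apply: eq_Rintegral => x _; ring.
rewrite RintegralB//.
- rewrite /Rintegral integral_expR_1sin integral_expR/=; ring.
- apply: ge0_integrable_half (integral_expR_1sin y); first by mfun.
  by move=> x; rewrite mulr_ge0 ?expR_ge0//; have := sin_geN1 (y * x); lra.
- by apply: ge0_integrable_half integral_expR; [mfun|move=> x; exact: expR_ge0].
Qed.

(** The damping factor of Abel summation. *)
Definition abel (w : R) : R := expR (- (e * `|w|)).

Lemma measurable_abel : measurable_fun setT abel.
Proof. by rewrite /abel; mfun. Qed.

Lemma abel_ge0 w : 0 <= abel w. Proof. exact: expR_ge0. Qed.

Lemma abel_le1 w : abel w <= 1.
Proof. by rewrite /abel -expR0 ler_expR oppr_le0 mulr_ge0// ltW. Qed.

Lemma integrable_abel : integrableR abel.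
Proof.
apply/integrableP; split; first by apply/measurable_EFinP; exact: measurable_abel.
under eq_integral do rewrite /= ger0_norm ?abel_ge0//.
rewrite ge0_symfun_integralT.
- have -> : (\int[mu]_(x in [set x | (0 <= x)%R]) (abel x)%:E =
      \int[mu]_(x in `[0%R, +oo[) (expR (- (e * x)))%:E)%E.
    rewrite -set_itvcy; apply: eq_integral => x.
    by rewrite inE/= in_itv/= andbT => x0; rewrite /abel ger0_norm.
  by rewrite integral_expR -EFinM ltry.
- exact: abel_ge0.
- move=> x; rewrite /abel.
  apply: (@continuous_comp _ _ _ (fun w : R => - (e * `|w|)) expR).
    by apply: cvgN; apply: cvgM; [exact: cvg_cst|apply: cvg_norm; exact: cvg_id].
  exact: continuous_expR.
- by move=> x /=; rewrite /abel normrN.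
Qed.

End exponential_integrals.
End half_line_integrals.

(** * The Poisson kernel and Bessel's inequality *)

Section poisson.
Context {R : realType}.
Notation mu := (@lebesgue_measure R).
Implicit Types (f g h : R -> R) (e : R).

(** The Poisson kernel and the conjugate Poisson kernel, without the usual factor
    [1 / pi]. *)
Definition pois e (s : R) : R := e / (e ^+ 2 + s ^+ 2).
Definition cpois e (s : R) : R := s / (e ^+ 2 + s ^+ 2).

Lemma pois_den_gt0 e s : 0 < e -> 0 < e ^+ 2 + s ^+ 2.
Proof. by move=> e0; rewrite ltr_wpDr ?sqr_ge0// exprn_gt0. Qed.

Lemma pois_ge0 e s : 0 < e -> 0 <= pois e s.
Proof. by move=> e0; rewrite divr_ge0 ?ltW// pois_den_gt0. Qed.

Lemma pois_le e s : 0 < e -> pois e s <= e^-1.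
Proof.
move=> e0; rewrite ler_pdivrMr ?pois_den_gt0// mulrDr expr2 mulKf ?gt_eqF//.
by rewrite lerDl mulr_ge0 ?sqr_ge0// invr_ge0 ltW.
Qed.

Lemma measurable_fun_pois e d (T : measurableType d) (f : T -> R) : measurable_fun setT f ->
  measurable_fun setT (fun x => pois e (f x)).
Proof. by move=> mf; rewrite /pois; mfun. Qed.

Lemma measurable_fun_cpois e d (T : measurableType d) (f : T -> R) : measurable_fun setT f ->
  measurable_fun setT (fun x => cpois e (f x)).
Proof. by move=> mf; rewrite /cpois; mfun. Qed.

Lemma continuous_pois e : 0 < e -> continuous (pois e).
Proof.
move=> e0 x; apply: cvgM; first exact: cvg_cst.
apply: cvgV; first by rewrite gt_eqF// pois_den_gt0.
by apply: cvgD; [exact: cvg_cst|exact: exprn_continuous].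
Qed.

Lemma integral_pois_half e : 0 < e ->
  (\int[mu]_(x in `[0%R, +oo[) (pois e x)%:E = (pi / 2)%:E)%E.
Proof.
move=> e0; have e1 : e != 0 by rewrite gt_eqF.
apply: etrans; [apply: (@FTC_pinfty _ _ (fun x => atan (x / e)) 0 (pi / 2))|].
- move=> x; apply: is_derive_eq.
  have := pois_den_gt0 x e0; rewrite /pois /GRing.scale/= => /gt_eqF h.
  have h2 : 1 + (x / e) ^+ 2 != 0 by rewrite gt_eqF// ltr_wpDr ?sqr_ge0.
  field; rewrite ?h ?h2 ?e1//=.
- exact: continuous_pois.
- by move=> x _; exact: pois_ge0.
- apply: (cvg_comp (fun x => x / e) atan _ (@cvgy_atan R)).
  by apply: gt0_cvgMly; [rewrite invr_gt0|exact: cvg_id].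
- by rewrite /= mul0r atan0 subr0.
Qed.

Lemma integral_pois c e : 0 < e -> (\int[mu]_x (pois e (c - x))%:E = pi%:E)%E.
Proof.
move=> e0; rewrite (ge0_integral_reflect c (f := fun x => (pois e x)%:E)); last 2 first.
- by apply/measurable_EFinP; apply: measurable_fun_pois; mfun.
- by move=> x; rewrite lee_fin pois_ge0.
rewrite ge0_symfun_integralT.
- by rewrite -set_itvcy integral_pois_half// -EFinM mulrC divfK.
- by move=> x; rewrite pois_ge0.
- exact: continuous_pois.
- by move=> x /=; rewrite /pois sqrrN.
Qed.

Lemma integrable_pois c e : 0 < e -> integrableR (fun x => pois e (c - x)).
Proof.
move=> e0; apply/integrableP; split.
  by apply/measurable_EFinP; apply: measurable_fun_pois; mfun.
by under eq_integral do rewrite /= ger0_norm ?pois_ge0//; rewrite integral_pois// ltry.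
Qed.

Lemma bounded_integrable_sqint f (M : R) : integrableR f -> (forall x, `|f x| <= M) -> sqint f.
Proof.
move=> fi fM; have mf := integrableR_measurable fi; split => //.
have i2 : integrableR (fun x => f x ^+ 2).
  apply: (le_integrableR (g := fun x => M * `|f x|)); first by mfun.
    by move=> x; rewrite normrX expr2 ler_wpM2r.
  by apply: integrableRZ; exact: integrableR_norm.
by rewrite /sqnorm -EFin_Rintegral ?ltry.
Qed.

Lemma sqint_pois c e : 0 < e -> sqint (fun x => pois e (c - x)).
Proof.
move=> e0; apply: (bounded_integrable_sqint (integrable_pois c e0) (M := e^-1)).
by move=> x; rewrite ger0_norm ?pois_ge0// pois_le.
Qed.

(** Averaging a nonnegative function against the Poisson kernel multiplies its
    integral by the mass [pi] of the kernel. *)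
Lemma Rintegral_pois_conv f e : 0 < e -> integrableR f -> (forall x, 0 <= f x) ->
  integrableR (fun t => \int[mu]_s (f s * pois e (t - s))) /\
  \int[mu]_t (\int[mu]_s (f s * pois e (t - s))) = pi * \int[mu]_s f s.
Proof.
move=> e0 fi f0; have mf := integrableR_measurable fi.
have mk : measurable_fun setT (fun z : R * R => f z.2 * pois e (z.1 - z.2)).
  by apply: measurable_funM; [apply: (measurableT_comp mf)|apply: measurable_fun_pois]; mfun.
have mk' : measurable_fun setT (fun z : R * R => (f z.2 * pois e (z.1 - z.2))%:E).
  exact/measurable_EFinP.
have mP := measurable_Rintegral_param mk.
have P0 t : 0 <= \int[mu]_s (f s * pois e (t - s)).
  by apply: Rintegral_ge0 => s _; rewrite mulr_ge0// pois_ge0.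
have PE : (\int[mu]_t (\int[mu]_s (f s * pois e (t - s)))%:E = (pi * \int[mu]_s f s)%:E)%E.
  under eq_integral => t _.
    rewrite EFin_Rintegral; first over.
    apply: (le_integrableR (g := fun s => e^-1 * f s)).
    - by apply: measurable_funM => //; apply: measurable_fun_pois; mfun.
    - by move=> s; rewrite normrM !ger0_norm ?pois_ge0// mulrC ler_wpM2r// pois_le.
    - exact: integrableRZ.
  rewrite (fubini_tonelli (m1 := mu) (m2 := mu)
      (fun z : R * R => (f z.2 * pois e (z.1 - z.2))%:E)) //=; last first.
    by move=> z; rewrite lee_fin mulr_ge0// pois_ge0.
  rewrite mulrC -RintegralZr// EFin_Rintegral; last exact: integrableRZr.
  apply: eq_integral => s _; under eq_integral do rewrite EFinM.
  rewrite ge0_integralZl//.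
  - rewrite EFinM; congr (_ * _)%E; rewrite -[RHS](integral_pois s e0).
    by apply: eq_integral => t _; rewrite /pois -(sqrrN (t - s)) opprB.
  - by apply/measurable_EFinP; apply: measurable_fun_pois; mfun.
  - by move=> x _; rewrite lee_fin pois_ge0.
  - by rewrite lee_fin.
split; last by rewrite {1}/Rintegral PE.
apply/integrableP; split; first exact/measurable_EFinP.
by under eq_integral do rewrite /= ger0_norm//; rewrite PE ltry.
Qed.

Lemma integrable_abel_cas e x : 0 < e -> integrableR (fun w => abel e w * cas (x * w)).
Proof. by move=> e0; exact/integrable_hart/integrable_abel. Qed.

Lemma sqint_abel_cas e x : 0 < e -> sqint (fun w => abel e w * cas (x * w)).
Proof.
move=> e0; apply: (bounded_integrable_sqint (integrable_abel_cas x e0) (M := 2)) => w.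
rewrite normrM -[leRHS]mul1r ler_pM// ?norm_cas_le// ger0_norm ?abel_ge0//.
exact: abel_le1.
Qed.

(** The function whose Hartley transform is twice the conjugate Poisson kernel; the
    sign and the argument [- x] come from the reflection in [sgflip]. *)
Definition conj_abel_cas e (x w : R) := - Num.sg w * (abel e w * cas (- x * w)).

Lemma norm_conj_abel_cas_le e x w :
  `|conj_abel_cas e x w| <= `|abel e w * cas (- x * w)|.
Proof.
rewrite /conj_abel_cas normrM normrN normr_sg ler_piMl//.
by case: (w != 0).
Qed.

Lemma measurable_conj_abel_cas e x : measurable_fun setT (conj_abel_cas e x).
Proof. by rewrite /conj_abel_cas /abel; mfun. Qed.

Lemma integrable_conj_abel_cas e x : 0 < e -> integrableR (conj_abel_cas e x).
Proof.
move=> e0; have := integrableR_norm (integrable_abel_cas (- x) e0).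
apply: le_integrableR; first exact: measurable_conj_abel_cas.
exact: norm_conj_abel_cas_le.
Qed.

Lemma sqint_conj_abel_cas e x : 0 < e -> sqint (conj_abel_cas e x).
Proof.
move=> e0; have := sqint_abel_cas (- x) e0; apply: le_sqint.
  exact: measurable_conj_abel_cas.
exact: norm_conj_abel_cas_le.
Qed.

Lemma integrable_half_expR e g : 0 < e -> measurable_fun setT g ->
  (forall x, `|g x| <= 1) ->
  mu.-integrable `[0, +oo[ (EFin \o (fun w => expR (- (e * w)) * g w)).
Proof.
move=> e0 mg g1.
have mI : measurable (`[0%R, +oo[ : set (measurableTypeR R)) by exact: measurable_itv.
have ag : integrableR (fun w => abel e w * g w).
  apply: le_integrableR (integrable_abel e0).
    by apply: measurable_funM => //; exact: measurable_abel.
  by move=> w; rewrite normrM (ger0_norm (abel_ge0 _ _)) ler_piMr// abel_ge0.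
have := integrableS measurableT mI (@subsetT _ _) ag.
apply: eq_integrable => // w; rewrite inE/= in_itv/= andbT => w0.
by rewrite /abel ger0_norm.
Qed.

(** Pairing the frequencies [w] and [- w] leaves only [2 cos ((x - t) w)] out of the
    product of the two [cas] factors. *)
Lemma hart_abel_cas e x t : 0 < e ->
  hart (fun w => abel e w * cas (x * w)) t = 2 * pois e (x - t).
Proof.
move=> e0; rewrite /hart Rintegral_halves; last exact/integrable_hart/integrable_abel_cas.
rewrite /pois -(Rintegral_expR_cos e0) -RintegralZl//.
  apply: eq_Rintegral => w; rewrite inE/= in_itv/= andbT => w0.
  rewrite /abel normrN ger0_norm// !mulrN /cas !cosN !sinN mulrBl cosB; ring.
apply: integrable_half_expR => //; first by mfun.
by move=> w; rewrite ler_norml cos_geN1 cos_le1.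
Qed.

(** As above, but the sign makes the pairing retain [2 sin ((x - t) w)]. *)
Lemma hart_conj_abel_cas e x t : 0 < e ->
  hart (conj_abel_cas e x) t = 2 * cpois e (x - t).
Proof.
move=> e0; rewrite /hart Rintegral_halves; last exact/integrable_hart/integrable_conj_abel_cas.
rewrite /cpois -(Rintegral_expR_sin e0) -RintegralZl//.
  apply: eq_Rintegral => w; rewrite inE/= in_itv/= andbT => w0.
  rewrite /conj_abel_cas /abel normrN ger0_norm// sgrN.
  have [->|w1] := eqVneq w 0; first by rewrite sgr0 !mulr0 sin0; ring.
  have -> : Num.sg w = 1 by rewrite gtr0_sg// lt0r w1.
  rewrite !mulrN !mulNr /cas !cosN !sinN mulrBl sinB; ring.
apply: integrable_half_expR => //; first by mfun.
by move=> w; rewrite ler_norml sin_geN1 sin_le1.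
Qed.

(** Two applications of the multiplication formula rewrite the damped energy as
    [\int\int f t * f s * (2 pois e (t - s))]; bounding [2 f t f s] by
    [f t ^ 2 + f s ^ 2] splits it into two integrals of [f ^ 2] against a kernel of
    mass [pi]. *)
Lemma hart_abel_energy_le e f : 0 < e -> integrableR f -> sqint f ->
  \int[mu]_w (hart f w ^+ 2 * abel e w) <= 2 * pi * \int[mu]_t (f t ^+ 2).
Proof.
move=> e0 fi sf; have [mf _] := sf.
have iF2 := sqint_integrable_sqr sf.
have iP (t : R) : integrableR (fun s => 2 * pois e (t - s)).
  by apply: integrableRZ; exact: integrable_pois.
have iconv (g : R -> R) (t : R) : integrableR g -> integrableR (fun s => g s * pois e (t - s)).
  move=> gi; apply: (le_integrableR (g := fun s => e^-1 * `|g s|)).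
  - apply: measurable_funM; first exact: integrableR_measurable.
    by apply: measurable_fun_pois; mfun.
  - by move=> s; rewrite normrM mulrC ler_wpM2r// ger0_norm ?pois_ge0// pois_le.
  - by apply: integrableRZ; exact: integrableR_norm.
have -> : \int[mu]_w (hart f w ^+ 2 * abel e w) =
    \int[mu]_t (f t * (\int[mu]_s (f s * (2 * pois e (t - s))))).
  transitivity (\int[mu]_w (hart f w * (hart f w * abel e w))).
    by apply: eq_Rintegral => w _; rewrite mulrA.
  have ig := integrable_hartM fi (integrable_abel e0).
  rewrite (Rintegral_hartM fi ig); apply: eq_Rintegral => t _; congr (_ * _).
  transitivity (\int[mu]_w (hart f w * (abel e w * cas (t * w)))).
    by apply: eq_Rintegral => w _; rewrite mulrA.
  rewrite (Rintegral_hartM fi (integrable_abel_cas t e0)).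
  by apply: eq_Rintegral => s _; rewrite hart_abel_cas.
have [iC CE] := Rintegral_pois_conv e0 iF2 (fun x => sqr_ge0 (f x)).
have -> : 2 * pi * \int[mu]_t (f t ^+ 2) =
    \int[mu]_t (pi * f t ^+ 2 + \int[mu]_s (f s ^+ 2 * pois e (t - s))).
  by rewrite RintegralD// ?CE ?RintegralZl//; [ring|exact: integrableRZ].
have le_pt t : `|f t * \int[mu]_s (f s * (2 * pois e (t - s)))| <=
    pi * f t ^+ 2 + \int[mu]_s (f s ^+ 2 * pois e (t - s)).
  have -> : pi * f t ^+ 2 = \int[mu]_s (f t ^+ 2 * pois e (t - s)).
    by rewrite RintegralZl ?integrable_pois// /Rintegral integral_pois// mulrC.
  have i1 : integrableR (fun s => f s * (2 * pois e (t - s))).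
    have := integrableRZ 2 (iconv f t fi); apply: eq_integrable => // s _ /=.
    by congr EFin; ring.
  have i2 : integrableR (fun s => f t ^+ 2 * pois e (t - s)).
    by apply: integrableRZ; exact: integrable_pois.
  rewrite -RintegralD//; last exact: iconv.
  rewrite -RintegralZl//; apply: le_trans (le_normr_Rintegral _ _) _ => //.
    exact: integrableRZ.
  apply: le_Rintegral => //.
  - by apply: integrableR_norm; exact: integrableRZ.
  - by apply: integrableRD => //; exact: iconv.
  - move=> s _; have := pois_ge0 (t - s) e0; move: (pois e (t - s)) => p p0.
    rewrite !normrM (ger0_norm p0) (ger0_norm (ler0n _ 2)).
    rewrite -mulrDl !mulrA ler_wpM2r//.
    have := real_normK (num_real (f t)); have := real_normK (num_real (f s)).
    by have := sqr_ge0 (`|f t| - `|f s|); nra.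
apply: le_Rintegral => //.
- apply: le_integrableR le_pt _.
    apply: measurable_funM => //.
    apply: (measurable_Rintegral_param (g := fun z => f z.2 * (2 * pois e (z.1 - z.2)))).
    apply: measurable_funM; first by apply: (measurableT_comp mf); mfun.
    by apply: measurable_funM => //; apply: measurable_fun_pois; mfun.
  by apply: integrableRD => //; exact: integrableRZ.
- by apply: integrableRD => //; exact: integrableRZ.
- by move=> t _; apply: le_trans (ler_norm _) (le_pt t).
Qed.

(** The damping is removed by Fatou's lemma, applied to the damped transforms. *)
Lemma bessel_L1 f : integrableR f -> sqint f ->
  (sqnorm (hart f) <= (2 * pi)%:E * sqnorm f)%E.
Proof.
move=> fi sf; have [mf _] := sf; have mh := measurable_hart mf.
apply: (@sqnorm_fatou _ (fun n w => hart f w * abel (n.+1%:R^-1) w)).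
- by move=> n; apply: measurable_funM => //; exact: measurable_abel.
- by [].
- apply: aeW => w; rewrite -[X in _ --> X]mulr1.
  apply: cvgM; first exact: cvg_cst.
  rewrite /abel -[X in _ --> X]expR0; apply: continuous_cvg; first exact: continuous_expR.
  rewrite -oppr0; apply: cvgN; rewrite -(mul0r `|w|); apply: cvgM; last exact: cvg_cst.
  exact: cvg_harmonic.
- apply: nearW => n.
  have n0 : 0 < n.+1%:R^-1 :> R by rewrite invr_gt0.
  (* The square of [abel e] is [abel (2 * e)]. *)
  have n2 : 0 < 2 * n.+1%:R^-1 :> R by rewrite mulr_gt0.
  rewrite (EFin_sqnorm sf) -EFinM.
  have := hart_abel_energy_le n2 fi sf.
  rewrite -lee_fin; apply: le_trans.
  rewrite EFin_Rintegral; last first.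
    have := integrable_hartM fi (integrable_hartM fi (integrable_abel n2)).
    by apply: eq_integrable => // w _ /=; rewrite mulrA.
  rewrite /sqnorm le_eqVlt; apply/orP; left; apply/eqP.
  apply: eq_integral => w _; congr EFin; rewrite exprMn; congr (_ * _).
  by rewrite /abel -expRM_natl; congr expR; ring.
Qed.

End poisson.

(** * The Hartley transform of a square-integrable function *)

Section hartley_L2.
Context {R : realType}.
Notation mu := (@lebesgue_measure R).
Implicit Types (f g h : R -> R).

Lemma cvge0_le {I : Type} {F : set_system I} {FF : Filter F} (c : R)
    (a b : I -> \bar R) : (forall i, 0 <= a i)%E ->
  (forall i, a i <= c%:E * b i)%E -> b i @[i --> F] --> 0%E -> a i @[i --> F] --> 0%E.
Proof.
move=> a0 ab b0; apply: (@squeeze_cvge _ _ _ _ (cst 0%E) _ (fun i => c%:E * b i)%E).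
- by apply: nearW => i; rewrite a0 ab.
- exact: cvg_cst.
- by rewrite -[X in _ --> X](mule0 c%:E); apply: cvgeZl.
Qed.

Lemma le_sqnorm_hartB f g : integrableR f -> integrableR g -> sqint f -> sqint g ->
  (sqnorm (fun w => hart f w - hart g w)%R <= (2 * pi)%:E * sqnorm (fun t => f t - g t)%R)%E.
Proof.
move=> fi gi sf sg.
rewrite (_ : (fun w => _) = hart (fun t => f t - g t)); last first.
  by apply/funext => w; rewrite hartB.
by apply: bessel_L1; [exact: integrableRB|exact: sqintB].
Qed.

(** The Hartley counterpart of [is_fourier]. *)
Definition is_hart f h := sqint h /\
  sqnorm (fun w => hart (trunc A f) w - h w) @[A --> +oo] --> 0%E.

(** Truncations converging geometrically fast have, by Bessel's inequality,
    geometrically fast transforms, which converge almost everywhere; Fatou's lemma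
    turns this into convergence in mean for all truncations. *)
Lemma is_hart_exists f : sqint f -> exists2 h, is_hart f h &
  (sqnorm h <= (2 * pi)%:E * sqnorm f)%E.
Proof.
move=> sf; have [mf _] := sf; have f0 := cvg_sqnorm_trunc sf.
have iT A := integrable_trunc A sf.
have sT A := sqint_trunc A sf.
have mT A : measurable_fun setT (trunc A f) by case: (sT A).
have mH A := measurable_hart (mT A).
(* [k <= A k] is imposed so that the truncations exhaust the line. *)
have /choice[A_ AP] (k : nat) : exists A : R, k%:R <= A /\
    (sqnorm (fun x => f x - trunc A f x)%R <= (8 ^+ k)^-1%:E)%E.
  have k0 : 0 < (8 ^+ k)^-1 :> R by rewrite invr_gt0 exprn_gt0.
  have [M [_ MP]] : \forall A \near +oo, (sqnorm (fun x => f x - trunc A f x)%R <= (8 ^+ k)^-1%:E)%E.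
    move/fine_cvgP : f0 => [ffin /cvgr0Pnorm_le /(_ _ k0)]; apply: filterS2 ffin => A Afin.
    by rewrite ger0_norm ?fine_ge0 ?sqnorm_ge0// => h; rewrite -(fineK Afin) lee_fin.
  exists (Num.max k%:R (M + 1)); split; first by rewrite le_max lexx.
  by apply: MP; rewrite lt_max; apply/orP; right; lra.
have uC k : (sqnorm (fun w => hart (trunc (A_ k.+1) f) w - hart (trunc (A_ k) f) w)%R <=
    (8 * pi / 8 ^+ k)%:E)%E.
  apply: le_trans (le_sqnorm_hartB (iT _) (iT _) (sT _) (sT _)) _.
  have -> : (8 * pi / 8 ^+ k : R)%:E = ((2 * pi)%:E * (4 / 8 ^+ k)%:E)%E.
    by rewrite -EFinM; congr EFin; ring.
  apply: lee_wpmul2l; first by rewrite lee_fin mulr_ge0// pi_ge0.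
  rewrite (_ : (fun t => _) = (fun t => (f t - trunc (A_ k) f t) +
      - (f t - trunc (A_ k.+1) f t))); last by apply/funext => t; ring.
  apply: le_trans (le_sqnormD _ _) _.
  - exact: measurable_funB.
  - by apply: measurable_funN; exact: measurable_funB.
  rewrite sqnormN (_ : 4 / 8 ^+ k = 2 * ((8 ^+ k)^-1 + (8 ^+ k)^-1)); last by ring.
  rewrite EFinM; apply: lee_wpmul2l => //; rewrite EFinD; apply: leeD.
    by have [] := AP k.
  have [_ h] := AP k.+1; apply: le_trans h _; rewrite lee_fin lef_pV2 ?posrE ?exprn_gt0//.
  by rewrite exprS ler_peMl ?exprn_ge0// ler1n.
have [v mv uv] := L2_fast_cauchy_cvg (fun k => mH (A_ k)) uC.
have vle : (sqnorm v <= (2 * pi)%:E * sqnorm f)%E.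
  apply: (sqnorm_fatou (fun k => mH (A_ k)) mv uv); apply: nearW => k.
  apply: le_trans (bessel_L1 (iT _) (sT _)) _.
  apply: lee_wpmul2l; first by rewrite lee_fin mulr_ge0// pi_ge0.
  by apply: le_sqnorm => // x; exact: norm_trunc_le.
exists v => //; split.
  split => //; apply: le_lt_trans vle _.
  by rewrite EFin_sqnorm// -EFinM ltry.
apply: (cvge0_le (c := 2 * pi)) f0 => A; first exact: sqnorm_ge0.
apply: (@sqnorm_fatou _ (fun k w => hart (trunc A f) w - hart (trunc (A_ k) f) w)).
- by move=> k; exact: measurable_funB.
- exact: measurable_funB.
- by apply: aeS uv => w uw; apply: cvgB => //; exact: cvg_cst.
- near=> k; apply: le_trans (le_sqnorm_hartB (iT _) (iT _) (sT _) (sT _)) _.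
  apply: lee_wpmul2l; first by rewrite lee_fin mulr_ge0// pi_ge0.
  apply: le_sqnorm; try exact: measurable_funB.
  move=> x; have Ak : A <= A_ k.
    have [kA _] := AP k; apply: le_trans kA; near: k; exact: nbhs_infty_ger.
  rewrite /trunc !indicE !mem_setE.
  have [|] := boolP (x \in `[- A, A]); rewrite in_itv/= => xA.
    rewrite (_ : x \in _); first by rewrite subrr normr0.
    by move: xA; rewrite in_itv/=; lra.
  by case: (x \in _); rewrite ?mulr0 ?mulr1 ?subr0 ?sub0r ?normrN ?oppr0 ?normr0.
Unshelve. all: by end_near. Qed.

Lemma cvge0_eq0 {I : Type} {F : set_system I} {FF : ProperFilter F}
    (a : \bar R) (b : I -> \bar R) : (0 <= a)%E ->
  (forall i, a <= b i)%E -> b i @[i --> F] --> 0%E -> a = 0%E.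
Proof.
move=> a0 ab b0; apply/eqP; rewrite eq_le a0 andbT.
rewrite -(cvg_lim _ b0)//; apply: lime_ge; last exact: nearW.
by apply/cvg_ex; exists 0%E.
Qed.

Lemma L2_limit_unique {I : Type} {F : set_system I} {FF : ProperFilter F}
    (u : I -> R -> R) h h' : (forall i, measurable_fun setT (u i)) ->
  measurable_fun setT h -> measurable_fun setT h' ->
  sqnorm (fun w => u i w - h w) @[i --> F] --> 0%E ->
  sqnorm (fun w => u i w - h' w) @[i --> F] --> 0%E ->
  {ae mu, forall w, h w = h' w}.
Proof.
move=> mu_ mh mh' uh uh'.
have : sqnorm (fun w => h' w - h w) = 0%E.
  apply: (@cvge0_eq0 _ F _ _ (fun i => 2%:E *
    (sqnorm (fun w => u i w - h w)%R + sqnorm (fun w => u i w - h' w)%R))%E).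
  - exact: sqnorm_ge0.
  - move=> i; rewrite (_ : (fun w => _) = (fun w => (u i w - h w) + - (u i w - h' w))).
      apply: le_trans (le_sqnormD _ _) _; last by rewrite sqnormN.
        exact: measurable_funB.
      by apply: measurable_funN; exact: measurable_funB.
    by apply/funext => w; ring.
  - rewrite -[X in _ --> X](mule0 2%:E); apply: cvgeZl => //.
    by rewrite -[X in _ --> X](adde0 0%E); apply: cvgeD.
move=> /sqnorm_eq0 h0; have := h0 (measurable_funB mh' mh).
by apply: aeS => w /eqP; rewrite subr_eq0 => /eqP.
Qed.

Lemma is_hart_unique f h h' : measurable_fun setT f -> is_hart f h -> is_hart f h' ->
  {ae mu, forall w, h w = h' w}.
Proof.
move=> mf [[mh _] fh] [[mh' _] fh']; apply: L2_limit_unique fh fh' => // A.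
by apply: measurable_hart; exact: measurable_trunc.
Qed.

Lemma is_hart_bessel f h : sqint f -> is_hart f h ->
  (sqnorm h <= (2 * pi)%:E * sqnorm f)%E.
Proof.
move=> sf fh; have [h' fh' h'le] := is_hart_exists sf.
have [mf _] := sf; rewrite (@eq_ae_sqnorm _ h h')//; last exact: is_hart_unique fh fh'.
- by case: fh => -[].
- by case: fh' => -[].
Qed.

Lemma is_hart_ae_eqr f h h' : is_hart f h -> measurable_fun setT f ->
  measurable_fun setT h' ->
  {ae mu, forall w, h w = h' w} -> is_hart f h'.
Proof.
move=> [[mh hy] fh] mf mh' hh'; split; first by split => //; rewrite -(eq_ae_sqnorm mh).
suff E : (fun A => sqnorm (fun w => hart (trunc A f) w - h' w)) =
    (fun A => sqnorm (fun w => hart (trunc A f) w - h w)) by rewrite E.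
apply/funext => A; have mH : measurable_fun setT (hart (trunc A f)).
  by apply: measurable_hart; exact: measurable_trunc.
apply: eq_ae_sqnorm; try exact: measurable_funB.
by apply: aeS hh' => w ->.
Qed.

Lemma hart_ae_eq f g w : measurable_fun setT f -> measurable_fun setT g ->
  {ae mu, forall t, f t = g t} -> hart f w = hart g w.
Proof.
move=> mf mg fg; rewrite /hart /Rintegral; congr fine.
apply: ae_eq_integral => //; try by apply/measurable_EFinP; mfun.
by apply: aeS fg => t ->.
Qed.

Lemma is_hart_ae_eql f g h : is_hart f h -> measurable_fun setT f ->
  measurable_fun setT g -> {ae mu, forall t, f t = g t} -> is_hart g h.
Proof.
move=> [sh fh] mf mg fg; split; first exact: sh.
suff E : (fun A => sqnorm (fun w => hart (trunc A g) w - h w)) =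
    (fun A => sqnorm (fun w => hart (trunc A f) w - h w)) by rewrite E.
apply/funext => A; congr sqnorm; apply/funext => w.
rewrite (@hart_ae_eq (trunc A g) (trunc A f))//; try exact: measurable_trunc.
by apply: aeS fg => t; rewrite /trunc => ->.
Qed.

Lemma is_hartD f g h (k : R -> R) : sqint f -> sqint g -> is_hart f h -> is_hart g k ->
  is_hart (fun t => f t + g t) (fun w => h w + k w).
Proof.
move=> sf sg [sh fh] [sk gk]; split; first exact: sqintD.
have [mf _] := sf; have [mg _] := sg; have [mh _] := sh; have [mk _] := sk.
apply: (cvge0_le (c := 2) (b := fun A => sqnorm (fun w => hart (trunc A f) w - h w)%R +
   sqnorm (fun w => hart (trunc A g) w - k w)%R)%E).
- by move=> A; exact: sqnorm_ge0.
- move=> A; have mHf := measurable_hart (measurable_trunc A mf).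
  have mHg := measurable_hart (measurable_trunc A mg).
  rewrite (_ : (fun w => _) = fun w => (hart (trunc A f) w - h w) + (hart (trunc A g) w - k w)).
    by apply: le_sqnormD; exact: measurable_funB.
  apply/funext => w; rewrite (_ : trunc A _ = fun t => trunc A f t + trunc A g t).
    by rewrite hartD; [ring|exact: integrable_trunc|exact: integrable_trunc].
  by apply/funext => t; rewrite /trunc mulrDl.
- by rewrite -[X in _ --> X](adde0 0%E); apply: cvgeD.
Qed.

Lemma is_hartZ c f h : sqint f -> is_hart f h ->
  is_hart (fun t => c * f t) (fun w => c * h w).
Proof.
move=> sf [sh fh]; split; first exact: sqintZ.
have [mf _] := sf; have [mh _] := sh.
apply: (cvge0_le (c := c ^+ 2)) fh => A; first exact: sqnorm_ge0.
have mHf := measurable_hart (measurable_trunc A mf).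
rewrite -sqnormZ; last exact: measurable_funB.
rewrite (_ : (fun w => _) = fun w => c * (hart (trunc A f) w - h w))//.
apply/funext => w; rewrite (_ : trunc A _ = fun t => c * trunc A f t).
  by rewrite hartZ; [ring|exact: integrable_trunc].
by apply/funext => t; rewrite /trunc mulrA.
Qed.

Lemma is_hart_L1 f : integrableR f -> sqint f -> is_hart f (hart f).
Proof.
move=> fi sf; have [mf _] := sf; have bf := bessel_L1 fi sf; split.
  split; first exact: measurable_hart.
  by apply: le_lt_trans bf _; rewrite EFin_sqnorm// -EFinM ltry.
apply: (cvge0_le (c := 2 * pi)) (cvg_sqnorm_trunc sf) => A; first exact: sqnorm_ge0.
rewrite [X in (_ <= _ * X)%E]sqnorm_distC; apply: le_sqnorm_hartB => //.
  exact: integrable_trunc.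
exact: sqint_trunc.
Qed.

(** The multiplication formula survives the limit of the truncations because both
    sides converge weakly. *)
Lemma is_hart_Rintegral f h g : sqint f -> is_hart f h -> integrableR g -> sqint g ->
  \int[mu]_w (h w * g w) = \int[mu]_t (f t * hart g t).
Proof.
move=> sf [sh fh] gi sg; have [mf _] := sf; have [mh _] := sh.
have [sHg _] := is_hart_L1 gi sg.
have sH A : sqint (hart (trunc A f)).
  by have [] := is_hart_L1 (integrable_trunc A sf) (sqint_trunc A sf).
have l1 := cvg_RintegralM (fun A => sqintB (sH A) sh) sg fh.
have l2 := cvg_RintegralM (fun A => sqintB sf (sqint_trunc A sf)) sHg (cvg_sqnorm_trunc sf).
have iHg := sqint_integrableM sf sHg; have ihg := sqint_integrableM sh sg.
have E A : \int[mu]_w ((hart (trunc A f) w - h w) * g w) +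
    \int[mu]_t ((f t - trunc A f t) * hart g t) =
    \int[mu]_t (f t * hart g t) - \int[mu]_w (h w * g w).
  have iTA := integrable_trunc A sf.
  have i1 := integrable_hartM iTA gi.
  have i2 : integrableR (fun t => trunc A f t * hart g t).
    exact: sqint_integrableM (sqint_trunc A sf) sHg.
  transitivity ((\int[mu]_w (hart (trunc A f) w * g w) - \int[mu]_w (h w * g w)) +
      (\int[mu]_t (f t * hart g t) - \int[mu]_t (trunc A f t * hart g t))).
    by congr (_ + _); rewrite -RintegralB//; apply: eq_Rintegral => t _; rewrite mulrBl.
  by rewrite (Rintegral_hartM iTA gi); ring.
have FF : ProperFilter (pinfty_nbhs R) by exact: proper_pinfty_nbhs.
have L : (fun _ : R => \int[mu]_t (f t * hart g t) - \int[mu]_w (h w * g w)) A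
    @[A --> +oo] --> (0 : R).
  have := cvgD (l1 (@filter_filter _ _ FF)) (l2 (@filter_filter _ _ FF)).
  rewrite addr0 => /(_ (@filter_filter _ _ FF)); apply: cvg_trans.
  by apply: near_eq_cvg; apply: nearW => A; exact: E.
have /cvg_lim := L; rewrite lim_cst; last exact: Rhausdorff.
move=> /(_ (@Rhausdorff R))/eqP.
by rewrite subr_eq0 => /eqP.
Qed.


End hartley_L2.

(** * Poisson averages at a Lebesgue point *)

Section lebesgue_points.
Context {R : realType}.
Notation mu := (@lebesgue_measure R).
Implicit Types (f g h : R -> R).

(** The layer-cake decomposition of the Poisson kernel: it is a superposition of
    indicator functions of the intervals [-r, r]. *)
Lemma integral_pois_layer e (a : R) : 0 < e -> 0 <= a ->
  (\int[mu]_(r in `[a, +oo[) (2 * e * r / (e ^+ 2 + r ^+ 2) ^+ 2)%:E = (pois e a)%:E)%E.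
Proof.
move=> e0 a0; have den r := pois_den_gt0 r e0.
apply: etrans; [apply: (@FTC_pinfty _ (fun r => 2 * e * r / (e ^+ 2 + r ^+ 2) ^+ 2)
  (fun r => - pois e r) a 0)|].
- move=> r; rewrite /pois.
  have d1 : e ^+ 2 + r ^+ 2 != 0 by rewrite gt_eqF.
  apply: is_derive_eq; rewrite /GRing.scale/=; field.
  by rewrite d1.
- move=> r; apply: cvgM.
    by apply: cvgM; [exact: cvg_cst|exact: cvg_id].
  apply: cvgV; first by rewrite expf_neq0// gt_eqF.
  apply: (@continuous_comp _ _ _ (fun r : R => e ^+ 2 + r ^+ 2) (fun y : R => y ^+ 2)).
    by apply: cvgD; [exact: cvg_cst|exact: exprn_continuous].
  exact: exprn_continuous.
- move=> r ar; rewrite divr_ge0 ?sqr_ge0// !mulr_ge0//; first exact: ltW.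
  exact: le_trans ar.
- rewrite -oppr0; apply: cvgN; apply/cvgr0Pnorm_le => d d0; near=> r.
  have r0 : 0 < r by near: r; exact: nbhs_pinfty_gt.
  rewrite ger0_norm ?pois_ge0// ler_pdivrMr ?den//.
  have r1 : 1 <= r by near: r; apply: nbhs_pinfty_ge; exact: num_real.
  have : e / d <= r by near: r; apply: nbhs_pinfty_ge; exact: num_real.
  rewrite ler_pdivrMr// => h; apply: (le_trans h); rewrite mulrC ler_pM2l//.
  by apply: (@le_trans _ _ (r ^+ 2)); [rewrite expr2 ler_peMl//; exact: ltW|rewrite lerDr sqr_ge0].
- by rewrite /= sub0r opprK.
Unshelve. all: by end_near. Qed.

(** By the layer-cake decomposition an average against the Poisson kernel is a
    superposition of averages over balls, so a linear bound on the latter is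
    inherited uniformly in [e]. *)
Lemma integral_pois_le_of_balls e (x eta : R) (D : R -> R) : 0 < e -> 0 <= eta ->
  measurable_fun setT D -> (forall t, 0 <= D t) ->
  (forall r, 0 < r -> (\int[mu]_(t in [set t | (`|x - t| <= r)%R]) (D t)%:E <= (r * eta)%:E)%E) ->
  (\int[mu]_t (D t * pois e (x - t))%:E <= (pi * eta)%:E)%E.
Proof.
move=> e0 eta0 mD D0 DB.
pose q (r : R) := 2 * e * r / (e ^+ 2 + r ^+ 2) ^+ 2.
have den r := pois_den_gt0 r e0.
have mq : measurable_fun setT q by rewrite /q; mfun.
(* The region over which the layer-cake integral is taken: pairs of a point and
   a radius whose interval about [x] contains the point. *)
pose A : set (R * R) := [set z | `|x - z.1| <= z.2].
have mA : measurable A by apply: measurable_set_ler; mfun.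
pose g (z : R * R) := D z.1 * (q z.2 * \1_A z).
have q0 r : 0 <= r -> 0 <= q r.
  by move=> r0; rewrite divr_ge0 ?sqr_ge0// !mulr_ge0// ltW.
have A0 t r : A (t, r) -> 0 <= r by rewrite /A/=; exact: le_trans.
have g0 z : 0 <= g z.
  rewrite /g mulr_ge0// indicE; case: (boolP (z \in A)) => [|_]; last by rewrite mulr0.
  by rewrite inE mulr1; case: z => t r /A0/q0.
have mg : measurable_fun setT (EFin \o g).
  apply/measurable_EFinP; rewrite /g; apply: measurable_funM.
    by apply: (measurableT_comp mD); mfun.
  by apply: measurable_funM => //; apply: (measurableT_comp mq); mfun.
have -> : (\int[mu]_t (D t * pois e (x - t))%:E = \int[mu]_t \int[mu]_r (g (t, r))%:E)%E.
  apply: eq_integral => t _.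
  rewrite (_ : (fun r => (g (t, r))%:E) =
      fun r => ((D t)%:E * ((EFin \o q) \_ `[`|x - t|%R, +oo[ r))%E); last first.
    apply/funext => r; rewrite /g /patch indicE EFinM; congr (_ * _)%E.
    have -> : ((t, r) \in A) = (r \in `[`|x - t|%R, +oo[%classic).
      by apply/idP/idP; rewrite !inE/= in_itv/= andbT.
    by case: ifP; rewrite ?mulr1 ?mulr0.
  have mI : measurable (`[`|x - t|%R, +oo[ : set (measurableTypeR R)) by exact: measurable_itv.
  rewrite ge0_integralZl//.
  - rewrite -integral_mkcond (integral_pois_layer e0)// -EFinM; congr (_ * _)%:E.
    by rewrite /pois real_normK ?num_real.
  - apply/(measurable_restrictT _ mI); apply/measurable_EFinP; exact: measurable_funTS.
  - move=> r _; rewrite /patch; case: ifPn => //; rewrite inE/= in_itv/= andbT => xr.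
    by rewrite lee_fin q0// (le_trans _ xr).
  - by rewrite lee_fin.
rewrite (fubini_tonelli (m1 := mu) (m2 := mu) (EFin \o g))//=.
have mI : measurable (`[0%R, +oo[ : set (measurableTypeR R)) by exact: measurable_itv.
apply: (@le_trans _ _ (\int[mu]_(r in `[0%R, +oo[) ((2 * eta) * pois e r)%:E)%E); last first.
  under eq_integral do rewrite EFinM.
  rewrite ge0_integralZl//.
  - rewrite integral_pois_half// -EFinM lee_fin le_eqVlt; apply/orP; left; apply/eqP; by field.
  - by apply/measurable_EFinP; apply: measurable_funTS; apply: measurable_fun_pois; mfun.
  - by move=> r _; rewrite lee_fin pois_ge0.
  - by rewrite lee_fin mulr_ge0.
rewrite [leRHS]integral_mkcond; apply: ge0_le_integral => //.
- by move=> r _; apply: integral_ge0 => t _; rewrite lee_fin.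
- exact: (measurable_fun_fubini_tonelli_G (m1 := mu) (EFin \o g) mg).
- apply/(measurable_restrictT _ mI); apply/measurable_EFinP; apply: measurable_funTS.
  by apply: measurable_funM => //; apply: measurable_fun_pois; mfun.
- move=> r _; pose B := [set t | `|x - t| <= r].
  have mB : measurable B by apply: measurable_set_ler; mfun.
  have [r0|r0] := leP r 0.
    rewrite (_ : (fun t => _) = cst 0%E) ?integral0.
      rewrite /patch; case: ifPn => // _; rewrite lee_fin mulr_ge0 ?pois_ge0//.
      by rewrite mulr_ge0.
    apply/funext => t; rewrite /g indicE; case: (boolP ((t, r) \in A)) => [|_].
      rewrite inE => /A0 r1; have -> : r = 0 by apply/eqP; rewrite eq_le r0 r1.
      by rewrite /= /q mulr0 !mul0r mulr0.
    by rewrite !mulr0.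
  rewrite (_ : (fun t => (g (t, r))%:E) =
      fun t => ((q r)%:E * ((EFin \o D) \_ B t))%E); last first.
    apply/funext => t; rewrite /g /patch indicE mulrCA EFinM.
    have -> : ((t, r) \in A) = (t \in B) by apply/idP/idP; rewrite !inE.
    by case: ifP; rewrite ?mulr1 ?mulr0 ?mul1r//= EFinM.
  rewrite ge0_integralZl//.
  + rewrite -integral_mkcond; apply: le_trans (lee_wpmul2l _ (DB r r0)) _.
      by rewrite lee_fin q0 ?ltW.
    rewrite -EFinM /patch ifT; last by rewrite inE/= in_itv/= andbT ltW.
    rewrite lee_fin /q /pois.
    rewrite (_ : 2 * eta * _ = 2 * e * eta * (e ^+ 2 + r ^+ 2) / (e ^+ 2 + r ^+ 2) ^+ 2).
      rewrite mulrAC ler_wpM2r ?invr_ge0 ?sqr_ge0//.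
      have : 0 <= 2 * e * eta * e ^+ 2 by rewrite !mulr_ge0// ?sqr_ge0// ltW.
      by nra.
    by field; rewrite gt_eqF.
  + by apply/(measurable_restrictT _ mB); apply/measurable_EFinP; exact: measurable_funTS.
  + by move=> t _; rewrite /patch; case: ifP => // _; rewrite lee_fin.
  + by rewrite lee_fin q0// ltW.
Qed.

Lemma lebesgue_pt_ball f x (eta : R) : lebesgue_pt f x -> 0 < eta ->
  exists2 rho : R, 0 < rho & forall r, 0 < r -> r < rho ->
    (\int[mu]_(t in ball x r) (`|f t - f x|%R)%:E <= (2 * r * eta)%:E)%E.
Proof.
move=> xf eta0; move/fine_cvgP : xf => [ffin /cvgr0Pnorm_le /(_ _ eta0)].
move=> h; have [rho /= rho0 H] := filterI ffin h.
exists rho => // r r0 rr; have := H r; rewrite /= sub0r normrN gtr0_norm// => /(_ rr r0).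
rewrite /davg /iavg lebesgue_measure_ball; last exact: ltW.
set I := (\int[mu]_(y in _) _)%E => -[Hfin].
have r20 : r *+ 2 != 0 by rewrite mulrn_eq0/= gt_eqF.
have I0 : (0 <= I)%E by exact: integral_ge0.
rewrite ger0_norm; last by rewrite fine_ge0// mule_ge0// inve_ge0 lee_fin mulrn_wge0// ltW.
rewrite -lee_fin fineK// inver (negbTE r20) => {}H.
have r2 : (0 <= (r *+ 2)%:E)%E by rewrite lee_fin mulrn_wge0// ltW.
have := lee_wpmul2l r2 H.
by rewrite muleA -EFinM mulfV// mul1e -EFinM mulr_natl.
Qed.

End lebesgue_points.

Section poisson_limits.
Context {R : realType}.
Notation mu := (@lebesgue_measure R).
Implicit Types (f g h : R -> R).

Lemma sqint_norm f : sqint f -> sqint (fun t => `|f t|).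
Proof.
move=> sf; have [mf _] := sf; apply: le_sqint sf; first by mfun.
by move=> t; rewrite normr_id.
Qed.

Lemma integrable_mul_pois f e x : 0 < e -> sqint f ->
  integrableR (fun t => f t * pois e (x - t)).
Proof. by move=> e0 sf; apply: sqint_integrableM => //; exact: sqint_pois. Qed.

Lemma integrable_dist_pois f e x (c : R) : 0 < e -> sqint f ->
  integrableR (fun t => `|f t - c| * pois e (x - t)).
Proof.
move=> e0 sf; have [mf _] := sf.
apply: (le_integrableR (g := fun t => `|f t| * pois e (x - t) + `|c| * pois e (x - t))).
- by apply: measurable_funM; [mfun|apply: measurable_fun_pois; mfun].
- move=> t; have := pois_ge0 (x - t) e0; move: (pois e (x - t)) => p p0.
  by rewrite normrM normr_id (ger0_norm p0) -mulrDl ler_wpM2r// ler_normB.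
- apply: integrableRD; first by apply: integrable_mul_pois => //; exact: sqint_norm.
  by apply: integrableRZ; exact: integrable_pois.
Qed.

(** Near [x] the averages over balls are small because [x] is a Lebesgue point.  Away
    from [x] the kernel is at most [e] times a fixed multiple of [pois 1], against
    which [f] is integrable. *)
Lemma cvg_dist_pois f x : sqint f -> lebesgue_pt f x ->
  \int[mu]_t (`|f t - f x| * pois e (x - t)) @[e --> 0^'+] --> (0 : R).
Proof.
move=> sf xf; have [mf _] := sf; apply/cvgr0Pnorm_le => d d0.
have pi0 := pi_gt0 R.
have eta0 : 0 < d / (8 * pi) by rewrite divr_gt0// mulr_gt0.
have [rho rho0 H] := lebesgue_pt_ball xf eta0.
(* A closed ball of radius [m <= del] lies in the open ball of radius [2 m < rho];
   the factor [8 pi] in the tolerance pays for this and for the mass [pi]. *)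
pose del := rho / 3; have del0 : 0 < del by rewrite divr_gt0.
pose B := [set t | `|x - t| <= del].
have mB : measurable B by apply: measurable_set_ler; mfun.
pose D1 t := `|f t - f x| * \1_B t.
have mD1 : measurable_fun setT D1 by apply: measurable_funM => //; mfun.
have D10 t : 0 <= D1 t by rewrite mulr_ge0// indicE.
have mD : measurable_fun setT (fun t => (`|f t - f x|)%:E) by apply/measurable_EFinP; mfun.
have D1B (r : R) : 0 < r -> (\int[mu]_(t in [set t | (`|x - t| <= r)%R]) (D1 t)%:E <=
    (r * (4 * (d / (8 * pi))))%:E)%E.
  move=> r0; pose m := Num.min r del.
  have m0 : 0 < m by rewrite lt_min r0.
  have m2 : 0 < 2 * m by rewrite mulr_gt0.
  have m2r : 2 * m < rho.
    have : m <= del by rewrite ge_min lexx orbT.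
    rewrite /del; lra.
  have mr : m <= r by rewrite ge_min lexx.
  have mS : measurable [set t | `|x - t| <= r] by apply: measurable_set_ler; mfun.
  apply: (@le_trans _ _ (\int[mu]_(t in ball x (2 * m)%R) (`|f t - f x|%R)%:E)%E).
    rewrite integral_mkcond [leRHS]integral_mkcond.
    have mb : measurable (ball x (2 * m)) by exact: measurable_ball.
    apply: ge0_le_integral => //.
    - by move=> t _; rewrite /patch; case: ifP => // _; rewrite lee_fin.
    - by apply/(measurable_restrictT _ mS)/measurable_EFinP; exact: measurable_funTS.
    - by apply/(measurable_restrictT _ mb)/measurable_EFinP; apply: measurable_funTS; mfun.
    - move=> t _; rewrite /patch; case: ifPn; last first.
        by move=> _; case: ifPn => // _; rewrite lee_fin.
      rewrite inE/= => tr; rewrite /D1 indicE; case: (boolP (t \in B)) => tB; last first.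
        by rewrite mulr0; case: ifPn => // _; rewrite lee_fin.
      rewrite mulr1 ifT// inE /ball/=; apply: (@le_lt_trans _ _ m); last lra.
      by rewrite le_min tr/=; move: tB; rewrite inE.
  apply: le_trans (H _ m2 m2r) _; rewrite lee_fin; move: (d / (8 * pi)) eta0 => y y0; nra.
pose c : R := 1 + del ^- 2.
have c0 : 0 < c by rewrite ltr_wpDr ?invr_ge0 ?sqr_ge0.
pose K := \int[mu]_t (`|f t - f x| * pois 1 (x - t)).
have K0 : 0 <= K by apply: Rintegral_ge0 => t _; rewrite mulr_ge0// pois_ge0.
have dK0 : 0 < d / 2 / (c * (K + 1)) by rewrite !divr_gt0// mulr_gt0//; lra.
near=> e; have e0 : 0 < e by [].
have iD1 : integrableR (fun t => D1 t * pois e (x - t)).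
  have := integrable_dist_pois x (f x) e0 sf; apply: le_integrableR.
    by apply: measurable_funM => //; apply: measurable_fun_pois; mfun.
  move=> t; have := pois_ge0 (x - t) e0; move: (pois e (x - t)) => p p0.
  rewrite ger0_norm ?mulr_ge0// ler_wpM2r// /D1 indicE.
  by case: (_ \in _); rewrite ?mulr1 ?mulr0.
have i1 := integrable_dist_pois x (f x) (ltr01 : 0 < 1) sf.
rewrite ger0_norm; last first.
  by apply: Rintegral_ge0 => t _; rewrite mulr_ge0// pois_ge0.
apply: (@le_trans _ _ (\int[mu]_t (D1 t * pois e (x - t) +
    (e * c) * (`|f t - f x| * pois 1 (x - t))))).
  apply: le_Rintegral => //.
  - exact: integrable_dist_pois.
  - by apply: integrableRD => //; exact: integrableRZ.
  - move=> t _; rewrite /D1 indicE; case: (boolP (t \in B)) => tB.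
      rewrite mulr1 lerDl; apply: mulr_ge0; first exact/ltW/mulr_gt0.
      by apply: mulr_ge0 => //; exact: pois_ge0.
    rewrite mulr0 mul0r add0r [leRHS]mulrCA; apply: ler_wpM2l => //.
    have {}tB : del < `|x - t| by rewrite ltNge; apply: contra tB; rewrite inE.
    have {}tB : del ^+ 2 <= (x - t) ^+ 2.
      by rewrite -[leRHS]real_normK ?num_real// lerXn2r ?nnegrE// ltW.
    have s0 : 0 < (x - t) ^+ 2 by apply: lt_le_trans tB; rewrite exprn_gt0.
    rewrite /pois; move: ((x - t) ^+ 2) tB s0 => s tB s0.
    rewrite -mulrA ler_pM2l// div1r expr1n.
    rewrite (@le_trans _ _ s^-1)//.
      by rewrite lef_pV2 ?posrE// ?lerDr ?sqr_ge0// addr_gt0// exprn_gt0.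
    rewrite ler_pdivlMr; last by rewrite addr_gt0.
    rewrite mulrDr mulr1 mulVf ?gt_eqF// addrC lerD2l lef_pV2 ?posrE//.
    by rewrite exprn_gt0.
rewrite RintegralD//; last exact: integrableRZ.
rewrite RintegralZl// -/K.
apply: (@le_trans _ _ (pi * (4 * (d / (8 * pi))) + d / 2)).
  apply: lerD.
    rewrite -lee_fin EFin_Rintegral//; apply: integral_pois_le_of_balls => //.
    by rewrite mulr_ge0// ltW.
  apply: (@le_trans _ _ (e * (c * (K + 1)))).
    by rewrite -mulrA ler_pM2l// ler_pM2l//; lra.
  rewrite -ler_pdivlMr; last by rewrite mulr_gt0//; lra.
  near: e; exact: nbhs_right_le.
rewrite le_eqVlt; apply/orP; left; apply/eqP.
by clear -pi0; move: (@pi R) pi0 => p p0; field; rewrite gt_eqF.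
Unshelve. all: by end_near. Qed.

Lemma sqint_locally_integrable f : sqint f -> locally_integrable setT f.
Proof.
move=> sf; have [mf _] := sf; split => //; first exact: openT.
move=> K _ cK; have [M [_ MK]] := compact_bounded cK.
have mK := compact_measurable cK.
have /integrableP[_] := integrable_trunc (M + 1) sf.
apply: le_lt_trans; rewrite integral_mkcond; apply: ge0_le_integral => //.
- by move=> t _; rewrite /patch; case: ifP => // _; rewrite lee_fin.
- apply/(measurable_restrictT _ mK)/measurable_EFinP; apply: measurable_funTS; mfun.
- apply: measurableT_comp => //; apply/measurable_EFinP; exact: measurable_trunc.
- move=> t _; rewrite /patch; case: ifPn => [|_]; last exact: abse_ge0.
  rewrite inE => Kt; have M1 : M < M + 1 by rewrite ltrDl.
  have := MK _ M1 t Kt; rewrite /= ler_norml => tM.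
  by rewrite /trunc indicE mem_set ?mulr1//= in_itv.
Qed.

Lemma ae_lebesgue_pt f : sqint f -> {ae mu, forall x, lebesgue_pt f x}.
Proof. by move=> sf; apply: lebesgue_differentiation; exact: sqint_locally_integrable. Qed.

Lemma cvg_Rintegral_lebesgue_kernel f x (kap : R -> R -> R) : sqint f -> lebesgue_pt f x ->
  (forall e, 0 < e -> measurable_fun setT (kap e)) ->
  (forall e t, 0 < e -> `|kap e t| <= pois e (x - t)) ->
  \int[mu]_t ((f t - f x) * kap e t) @[e --> 0^'+] --> (0 : R).
Proof.
move=> sf xf mk kle; have [mf _] := sf.
have W := cvg_dist_pois sf xf.
apply/cvgr0Pnorm_le => d d0; move/cvgr0Pnorm_le : W => /(_ _ d0) W.
near=> e; have e0 : 0 < e by [].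
have ik : integrableR (fun t => (f t - f x) * kap e t).
  have := integrable_dist_pois x (f x) e0 sf; apply: le_integrableR.
    by apply: measurable_funM; [mfun|exact: mk].
  by move=> t; rewrite normrM ler_wpM2l// kle.
apply: le_trans (le_normr_Rintegral _ ik) _ => //.
have : `|\int[mu]_t (`|f t - f x| * pois e (x - t))| <= d by near: e.
apply: le_trans; apply: le_trans (ler_norm _); apply: le_Rintegral => //.
- exact: integrableR_norm.
- exact: integrable_dist_pois.
- by move=> t _; rewrite normrM ler_wpM2l// kle.
Unshelve. all: by end_near. Qed.

Lemma cvg_pois_conv f x : sqint f -> lebesgue_pt f x ->
  pi^-1 * \int[mu]_t (f t * pois e (x - t)) @[e --> 0^'+] --> f x.
Proof.
move=> sf xf.
have H := @cvg_Rintegral_lebesgue_kernel f x (fun e t => pois e (x - t)) sf xf.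
have {}H : \int[mu]_t ((f t - f x) * pois e (x - t)) @[e --> 0^'+] --> (0 : R).
  apply: H => [e e0|e t e0]; first by apply: measurable_fun_pois; mfun.
  by rewrite ger0_norm// pois_ge0.
have : pi^-1 * \int[mu]_t ((f t - f x) * pois e (x - t)) + f x @[e --> 0^'+] -->
    pi^-1 * 0 + f x.
  by apply: cvgD; [apply: cvgM; [exact: cvg_cst|exact: H]|exact: cvg_cst].
rewrite mulr0 add0r; apply: cvg_trans; apply: near_eq_cvg.
near=> e; have e0 : 0 < e by [].
rewrite /=.
transitivity (pi^-1 * (\int[mu]_t (f t * pois e (x - t)) - f x * pi) + f x).
  congr (_ * _ + _); transitivity (\int[mu]_t (f t * pois e (x - t) - f x * pois e (x - t))).
    by apply: eq_Rintegral => t _; rewrite mulrBl.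
  rewrite RintegralB//; last 2 first.
  - exact: integrable_mul_pois.
  - by apply: integrableRZ; exact: integrable_pois.
  rewrite RintegralZl//; last exact: integrable_pois.
  by rewrite {2}/Rintegral integral_pois.
rewrite mulrBr mulrCA mulVf ?mulr1 ?subrK//; by rewrite gt_eqF// pi_gt0.
Unshelve. all: by end_near. Qed.

End poisson_limits.

(** * Inversion and Plancherel *)

Section inversion.
Context {R : realType}.
Notation mu := (@lebesgue_measure R).
Implicit Types (f g h : R -> R).

Lemma is_hart_pois f h e x : sqint f -> is_hart f h -> 0 < e ->
  \int[mu]_w (h w * (abel e w * cas (x * w))) = 2 * \int[mu]_t (f t * pois e (x - t)).
Proof.
move=> sf fh e0; have ia := integrable_abel_cas x e0; have sa := sqint_abel_cas x e0.
rewrite (is_hart_Rintegral sf fh ia sa) -RintegralZl//; last exact: integrable_mul_pois.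
by apply: eq_Rintegral => t _; rewrite hart_abel_cas// mulrCA.
Qed.

Lemma is_hart_cpois f h e x : sqint f -> is_hart f h -> 0 < e ->
  \int[mu]_w (h w * conj_abel_cas e x w) = \int[mu]_t (f t * (2 * cpois e (x - t))).
Proof.
move=> sf fh e0; have ia := integrable_conj_abel_cas x e0.
have sa := sqint_conj_abel_cas x e0.
rewrite (is_hart_Rintegral sf fh ia sa).
by apply: eq_Rintegral => t _; rewrite hart_conj_abel_cas.
Qed.

Lemma sqnorm_dominated_cvg (u : nat -> R -> R) h : sqint h ->
  (forall n, measurable_fun setT (u n)) -> (forall n x, `|h x - u n x| <= `|h x|) ->
  (forall x, u n x @[n --> \oo] --> h x) ->
  sqnorm (fun x => h x - u n x) @[n --> \oo] --> 0%E.
Proof.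
move=> sh mu_ uh ucvg; have [mh _] := sh.
rewrite -(@integral0 _ _ _ mu setT).
pose g n x := ((h x - u n x) ^+ 2)%:E.
have mg n : measurable_fun setT (g n).
  by apply: measurable_fun_sqr_EFin; exact: measurable_funB.
have gcvg : {ae mu, forall x, setT x -> g n x @[n --> \oo] --> cst 0%E x}.
  apply: aeW => x _; apply: cvg_EFin; first exact: nearW.
  rewrite /g (_ : fine \o _ = fun n => (h x - u n x) ^+ 2)//.
  have : h x - u n x @[n --> \oo] --> h x - h x by apply: cvgB => //; exact: cvg_cst.
  rewrite subrr => l; rewrite -[X in _ --> X](mulr0 0).
  by under eq_fun do rewrite expr2; exact: cvgM.
have gdom : {ae mu, forall x n, setT x -> (`|g n x| <= (h x ^+ 2)%:E)%E}.
  apply: aeW => x n _; rewrite /= lee_fin ger0_norm ?sqr_ge0//.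
  rewrite -(real_normK (num_real (h x - u n x))) -(real_normK (num_real (h x))).
  by rewrite lerXn2r// nnegrE.
by have [] := @dominated_convergence _ _ _ mu setT measurableT g (cst 0%E) _
  mg (measurable_cst _) gcvg (sqint_integrable_sqr sh) gdom.
Qed.

Lemma sqint_abel e : 0 < e -> sqint (abel e : R -> R).
Proof.
move=> e0; apply: (bounded_integrable_sqint (integrable_abel e0) (M := 1)) => w.
by rewrite ger0_norm ?abel_ge0// abel_le1.
Qed.

Lemma is_hartB f g h (k : R -> R) : sqint f -> sqint g -> is_hart f h -> is_hart g k ->
  is_hart (fun t => f t - g t) (fun w => h w - k w).
Proof.
move=> sf sg fh gk.
have := is_hartD sf (sqintZ (-1) sg) fh (is_hartZ (-1) sg gk).
rewrite (_ : (fun t => f t + -1 * g t) = fun t => f t - g t); last first.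
  by apply/funext => t; rewrite mulN1r.
by rewrite (_ : (fun t => h t + -1 * k t) = fun t => h t - k t)//; apply/funext => t; rewrite mulN1r.
Qed.

(** Damping [h] makes it integrable, and its transform is then the Poisson average
    [2 \int f t * pois e (x - t)] at every point.  As [e] tends to [0] this converges
    to [k] in mean by Bessel's inequality and to [2 pi f] almost everywhere. *)
Lemma is_hart_involutive f h (k : R -> R) : sqint f -> is_hart f h -> is_hart h k ->
  {ae mu, forall x, k x = 2 * pi * f x}.
Proof.
move=> sf fh hk; have [sh _] := fh; have [sk _] := hk.
have [mf _] := sf; have [mh _] := sh; have [mk _] := sk.
pose e n : R := n.+1%:R^-1.
have e0 n : 0 < e n by rewrite invr_gt0.
pose he n w := h w * abel (e n) w.
have she n : sqint (he n).
  apply: le_sqint sh; first by apply: measurable_funM => //; exact: measurable_abel.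
  by move=> w; rewrite normrM ler_piMr// ger0_norm ?abel_ge0// abel_le1.
have ihe n : integrableR (he n) by apply: sqint_integrableM => //; exact: sqint_abel.
have heE n x : hart (he n) x = 2 * \int[mu]_t (f t * pois (e n) (x - t)).
  rewrite -(is_hart_pois x sf fh (e0 n)).
  by apply: eq_Rintegral => w _; rewrite mulrA.
have e_cvg : e n @[n --> \oo] --> (0 : R) by exact: cvg_harmonic.
have hecvg : sqnorm (fun x => h x - he n x) @[n --> \oo] --> 0%E.
  apply: sqnorm_dominated_cvg => //.
  - by move=> n; have [] := she n.
  - move=> n x; rewrite /he -{1}(mulr1 (h x)) -mulrBr normrM ler_piMr//.
    by rewrite ger0_norm ?subr_ge0 ?abel_le1// lerBlDr lerDl abel_ge0.
  - move=> x; rewrite /he -[X in _ --> X]mulr1; apply: cvgM; first exact: cvg_cst.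
    rewrite /abel -[X in _ --> X]expR0; apply: continuous_cvg; first exact: continuous_expR.
    rewrite -oppr0; apply: cvgN; rewrite -(mul0r `|x|); apply: cvgM => //; exact: cvg_cst.
have limk : {ae mu, forall x, k x - hart (he n) x @[n --> \oo] --> k x - 2 * pi * f x}.
  apply: aeS (ae_lebesgue_pt sf) => x fx; apply: cvgB; first exact: cvg_cst.
  have /cvg_at_rightP /(_ e) H := cvg_pois_conv sf fx.
  have {}H := H (conj e0 e_cvg).
  rewrite (_ : (fun n => hart (he n) x) =
      fun n => (2 * pi) * (pi^-1 * \int[mu]_t (f t * pois (e n) (x - t)))).
    by apply: cvgM; [exact: cvg_cst|exact: H].
  by apply/funext => n; rewrite heE mulrA -(mulrA 2) mulfV ?mulr1// gt_eqF// pi_gt0.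
have mhe n : measurable_fun setT (hart (he n)).
  by apply: measurable_hart; case: (she n).
have mlim : measurable_fun setT (fun x => k x - 2 * pi * f x) by mfun.
have shn n : sqint (fun w => h w - he n w) by exact: sqintB.
have kle n : (sqnorm (fun x => k x - hart (he n) x)%R <=
    (2 * pi)%:E * sqnorm (fun x => h x - he n x)%R)%E.
  by apply: is_hart_bessel => //; apply: is_hartB => //; exact: is_hart_L1.
have k0 : sqnorm (fun x => k x - hart (he n) x) @[n --> \oo] --> 0%E.
  by apply: cvge0_le kle hecvg => n; exact: sqnorm_ge0.
have z : sqnorm (fun x => k x - 2 * pi * f x) = 0%E.
  apply/eqP; rewrite eq_le sqnorm_ge0 andbT; apply/lee_addgt0Pr => d d0; rewrite add0e.
  apply: sqnorm_fatou (limk) _ => //; first by move=> n; exact: measurable_funB.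
  move/fine_cvgP : k0 => [kfin /cvgr0Pnorm_le /(_ _ d0)]; apply: filterS2 kfin => n nfin.
  by rewrite ger0_norm ?fine_ge0 ?sqnorm_ge0// => dn; rewrite -(fineK nfin) lee_fin.
by apply: aeS (sqnorm_eq0 mlim z) => x /eqP; rewrite subr_eq0 => /eqP.
Qed.

(** Plancherel's identity: Bessel's inequality for [h] and for the transform of [h],
    which is [2 pi f], force equality in both. *)
Lemma sqnorm_is_hart f h : sqint f -> is_hart f h ->
  sqnorm h = ((2 * pi)%:E * sqnorm f)%E.
Proof.
move=> sf fh; have [sh _] := fh; have [mf _] := sf.
have [k hk _] := is_hart_exists sh; have [[mk _] _] := hk.
have p0 : 0 < 2 * pi :> R by rewrite mulr_gt0// pi_gt0.
apply/eqP; rewrite eq_le (is_hart_bessel sf fh)/=.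
have := is_hart_bessel sh hk.
rewrite (eq_ae_sqnorm mk _ (is_hart_involutive sf fh hk)); last by mfun.
rewrite sqnormZ// !EFin_sqnorm// -!EFinM !lee_fin.
by move=> hh; rewrite -(ler_pM2l p0) mulrA -expr2.
Qed.

Lemma is_hart_surjective (k : R -> R) : sqint k -> exists2 g, sqint g & is_hart g k.
Proof.
move=> sk; have [mk _] := sk; have [k1 kk1 _] := is_hart_exists sk; have [sk1 _] := kk1.
have [k2 k1k2 _] := is_hart_exists sk1; have inv := is_hart_involutive sk kk1 k1k2.
exists (fun x => (2 * pi)^-1 * k1 x); first exact: sqintZ.
have [mk1 _] := sk1.
apply: is_hart_ae_eqr (is_hartZ (2 * pi)^-1 sk1 k1k2) _ mk _; first by mfun.
apply: aeS inv => w ->; rewrite mulKf//.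
by rewrite gt_eqF// mulr_gt0// pi_gt0.
Qed.

End inversion.

(** * The Hilbert transform on the frequency side *)

Section hilbert_transform.
Context {R : realType}.
Notation mu := (@lebesgue_measure R).
Implicit Types (f g h : R -> R).

(** The Hilbert transform on the side of Hartley transforms: multiplying the
    Fourier transform by [- j sgn w] exchanges its even and odd parts up to sign. *)
Definition sgflip h (w : R) : R := Num.sg w * h (- w).

Lemma sqint_sgflip h : sqint h -> sqint (sgflip h).
Proof.
move=> sh; have sN : sqint (fun w => h (- w)).
  by have := sqint_reflect 0 sh; under [X in sqint X -> _]eq_fun do rewrite sub0r.
have [mN _] := sN; apply: le_sqint sN; first by apply: measurable_funM => //; mfun.
by move=> w; rewrite normrM normr_sg ler_piMl//; case: (_ != 0).
Qed.

Definition hilbert_kernel (e x t : R) : R :=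
  (x - t)^-1 * \1_[set s | e < `|x - s|] t.

(** The error made when the conjugate Poisson kernel replaces the truncated
    kernel of the Hilbert transform. *)
Definition hilbert_diff (e x t : R) : R := hilbert_kernel e x t - cpois e (x - t).

Lemma measurable_hilbert_kernel e x : measurable_fun setT (hilbert_kernel e x).
Proof.
apply: measurable_funM; first by mfun.
by apply/measurable_indicP; apply: measurable_set_ltr; mfun.
Qed.

Lemma measurable_hilbert_diff e x : measurable_fun setT (hilbert_diff e x).
Proof.
apply: measurable_funB; first exact: measurable_hilbert_kernel.
by apply: measurable_fun_cpois; mfun.
Qed.

(** Outside the truncation the difference is [e^2 / (s (e^2 + s^2))] with [e < |s|];
    inside it is [- s / (e^2 + s^2)] with [|s| <= e].  Both are dominated by the
    Poisson kernel. *)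
Lemma norm_hilbert_diff_le e x t : 0 < e -> `|hilbert_diff e x t| <= pois e (x - t).
Proof.
move=> e0; rewrite /hilbert_diff /hilbert_kernel indicE.
have d0 := pois_den_gt0 (x - t) e0.
have -> : (t \in [set s | e < `|x - s|]) = (e < `|x - t|).
  by apply/idP/idP; rewrite inE.
case: (ltP e `|x - t|); move: (x - t) d0 => s d0.
  move=> es; have s0 : s != 0 by rewrite -normr_gt0; exact: lt_trans es.
  have -> : s^-1 * 1 - cpois e s = e ^+ 2 / (s * (e ^+ 2 + s ^+ 2)).
    by rewrite /cpois; field; rewrite s0 gt_eqF.
  rewrite (normrM (e ^+ 2)) normfV (normrM s) (gtr0_norm d0) normrX (gtr0_norm e0) /pois.
  rewrite invfM mulrA ler_wpM2r ?invr_ge0 ?(ltW d0)// ler_pdivrMr ?normr_gt0//.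
  by rewrite expr2 ler_wpM2l// ltW.
move=> se; rewrite mulr0 sub0r normrN /cpois /pois (normrM s) normfV.
by rewrite (gtr0_norm d0) ler_wpM2r// invr_ge0 ltW.
Qed.

Lemma hilbert_diff_odd e x t : hilbert_diff e x (2 * x - t) = - hilbert_diff e x t.
Proof.
rewrite /hilbert_diff /hilbert_kernel /cpois !indicE.
have -> : x - (2 * x - t) = - (x - t) by ring.
have -> : (2 * x - t \in [set s | e < `|x - s|]) = (t \in [set s | e < `|x - s|]).
  apply/idP/idP; rewrite !inE/=; have -> : x - (2 * x - t) = - (x - t) by ring.
    by rewrite normrN.
  by rewrite normrN.
by rewrite invrN sqrrN; ring.
Qed.

Lemma sqint_hilbert_diff e x : 0 < e -> sqint (hilbert_diff e x).
Proof.
move=> e0; apply: le_sqint (sqint_pois x e0); first exact: measurable_hilbert_diff.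
by move=> t; apply: le_trans (norm_hilbert_diff_le _ _ e0) (ler_norm _).
Qed.

Lemma integrable_hilbert_diff e x : 0 < e -> integrableR (hilbert_diff e x).
Proof.
move=> e0; apply: le_integrableR (integrable_pois x e0); first exact: measurable_hilbert_diff.
by move=> t; exact: norm_hilbert_diff_le.
Qed.

Lemma Rintegral_hilbert_diff e x : 0 < e -> \int[mu]_t (hilbert_diff e x t) = 0.
Proof.
move=> e0; have i := integrable_hilbert_diff x e0.
have := Rintegral_reflect (2 * x) (measurable_hilbert_diff e x).
under eq_Rintegral do rewrite hilbert_diff_odd -mulN1r.
rewrite RintegralZl//; lra.
Qed.

Lemma sqint_cpois (e x : R) : 0 < e -> sqint (fun t => cpois e (x - t)).
Proof.
move=> e0; have mc : measurable_fun setT (fun t : R => cpois e (x - t)).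
  by apply: measurable_fun_cpois; mfun.
split => //; rewrite /sqnorm.
have i2 : integrableR (fun t => cpois e (x - t) ^+ 2).
  apply: le_integrableR (integrableRZ e^-1 (integrable_pois x e0)); first by mfun.
  move=> t; rewrite ger0_norm ?sqr_ge0// /cpois /pois mulKf ?gt_eqF//.
  have := pois_den_gt0 (x - t) e0; move: (x - t) => s d0.
  rewrite exprMn exprVn expr2 -ler_pdivlMr; last by rewrite invr_gt0 exprn_gt0.
  rewrite invrK expr2 mulrA mulVf ?gt_eqF// mul1r -expr2 lerDr sqr_ge0.
  by [].
by rewrite -EFin_Rintegral ?ltry.
Qed.

Lemma sqint_hilbert_kernel e x : 0 < e -> sqint (hilbert_kernel e x).
Proof.
move=> e0; have := sqintD (sqint_hilbert_diff x e0) (sqint_cpois x e0).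
by under [X in sqint X -> _]eq_fun do rewrite /hilbert_diff subrK.
Qed.

Lemma truncated_hilbertE f e x :
  \int[mu]_(t in [set t | e < `|x - t|]) (f t / (x - t)) =
  \int[mu]_t (f t * hilbert_kernel e x t).
Proof.
rewrite Rintegral_mkcond; apply: eq_Rintegral => t _.
rewrite /hilbert_kernel /patch indicE mulrA; case: ifP => _; rewrite ?mulr1 ?mulr0//.
Qed.

(** The constant [f x] can be subtracted because the difference of the kernels is
    odd about [x], hence has integral zero. *)
Lemma truncated_hilbert_cpois f e x : 0 < e -> sqint f ->
  \int[mu]_t (f t * hilbert_kernel e x t) =
  \int[mu]_t ((f t - f x) * hilbert_diff e x t) + \int[mu]_t (f t * cpois e (x - t)).
Proof.
move=> e0 sf.
have i1 := sqint_integrableM sf (sqint_hilbert_diff x e0).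
have i2 := integrable_hilbert_diff x e0.
have i3 := sqint_integrableM sf (sqint_cpois x e0).
have i4 := sqint_integrableM sf (sqint_hilbert_kernel x e0).
transitivity (\int[mu]_t (f t * hilbert_diff e x t) + \int[mu]_t (f t * cpois e (x - t))).
  rewrite -RintegralD//; apply: eq_Rintegral => t _.
  by rewrite -mulrDr /hilbert_diff subrK.
congr (_ + _); transitivity (\int[mu]_t (f t * hilbert_diff e x t - f x * hilbert_diff e x t)).
  by rewrite RintegralB//; [rewrite RintegralZl// Rintegral_hilbert_diff// mulr0 subr0|exact: integrableRZ].
by apply: eq_Rintegral => t _; rewrite mulrBl.
Qed.

(** The multiplication formula for [g] and for [f], applied to functions whose
    Hartley transforms are the two kernels, gives integrals of [h] that differ by
    the change of variable [w |-> - w]. *)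
Lemma pois_conv_sgflip f g h e x : sqint f -> sqint g -> is_hart f h ->
  is_hart g (sgflip h) -> 0 < e ->
  \int[mu]_t (g t * pois e (x - t)) = \int[mu]_t (f t * cpois e (x - t)).
Proof.
move=> sf sg fh gk e0; have [[mh _] _] := fh; have [sk _] := gk; have [mk _] := sk.
have H1 := is_hart_pois x sg gk e0; have H2 := is_hart_cpois x sf fh e0.
have : \int[mu]_w (sgflip h w * (abel e w * cas (x * w))) =
    \int[mu]_w (h w * conj_abel_cas e x w).
  rewrite -[LHS](Rintegral_reflect 0).
    apply: eq_Rintegral => w _; rewrite sub0r /sgflip /conj_abel_cas opprK sgrN /abel normrN.
    by rewrite (_ : x * - w = - x * w); ring.
  by apply: measurable_funM => //; rewrite /abel; mfun.
rewrite H1 H2 => H3; apply: (mulfI (x := 2)); first by [].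
rewrite H3 -RintegralZl//; first by apply: eq_Rintegral => t _; ring.
by apply: sqint_integrableM => //; exact: sqint_cpois.
Qed.

(** At a common Lebesgue point of [f] and [g] the truncated integral differs by a
    vanishing error from the Poisson average of [g], which tends to [g x]. *)
Lemma ae_truncated_hilbert_cvg f g h : sqint f -> sqint g -> is_hart f h ->
  is_hart g (sgflip h) ->
  {ae mu, forall x, pi^-1 * \int[mu]_t (f t * hilbert_kernel e x t) @[e --> 0^'+] --> g x}.
Proof.
move=> sf sg fh gk; have := aeI (ae_lebesgue_pt sf) (ae_lebesgue_pt sg).
apply: aeS => x [fx gx].
have H1 := cvg_pois_conv sg gx.
have H2 : \int[mu]_t ((f t - f x) * hilbert_diff e x t) @[e --> 0^'+] --> (0 : R).
  apply: cvg_Rintegral_lebesgue_kernel => // [e e0|e t e0].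
    exact: measurable_hilbert_diff.
  exact: norm_hilbert_diff_le.
have : pi^-1 * \int[mu]_t ((f t - f x) * hilbert_diff e x t) +
    pi^-1 * \int[mu]_t (g t * pois e (x - t)) @[e --> 0^'+] --> pi^-1 * 0 + g x.
  by apply: cvgD => //; apply: cvgM => //; exact: cvg_cst.
rewrite mulr0 add0r; apply: cvg_trans; apply: near_eq_cvg.
near=> e; have e0 : 0 < e by [].
by rewrite truncated_hilbert_cpois// (pois_conv_sgflip x sf sg fh gk e0) mulrDr.
Unshelve. all: by end_near. Qed.

Lemma hilbert_ae_eq f g h : sqint f -> sqint g -> is_hart f h ->
  is_hart g (sgflip h) -> {ae mu, forall x, hilbert f x = g x}.
Proof.
move=> sf sg fh gk; apply: aeS (ae_truncated_hilbert_cvg sf sg fh gk) => x fx.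
rewrite /hilbert; apply/cvg_lim; first exact: Rhausdorff.
by under eq_fun do rewrite truncated_hilbertE.
Qed.

End hilbert_transform.

(** * Borel measurability of the Hilbert transform *)

Section hilbert_measurable.
Context {R : realType}.
Notation mu := (@lebesgue_measure R).
Implicit Types (f g h : R -> R).

(** Right continuity in [e] lets the Cauchy criterion be tested on rational [e], so
    the set of convergence is Borel; on it the limit is taken along a sequence, and
    off it [lim] is constant. *)
Lemma measurable_lim_at_right (H : R -> R -> R) :
  (forall e, measurable_fun setT (H e)) ->
  (forall t e, 0 < e -> H p t @[p --> e^'+] --> H e t) ->
  measurable_fun setT (fun t => lim (H e t @[e --> 0^'+])).
Proof.
move=> mH Hright.
pose b n : R := n.+1%:R^-1.
have b0 n : 0 < b n by rewrite invr_gt0.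
pose D : set R := \bigcap_k \bigcup_n \bigcap_(p : rat)
  [set t | 0 < (ratr p : R) < b n -> `|H (ratr p) t - H (b n.+1) t| <= b k].
have mD : measurable D.
  apply: bigcap_measurable => // k _; apply: bigcup_measurable => n _.
  rewrite -[X in measurable X]setCK setC_bigcap; apply: measurableC.
  apply: bigcupT_measurable_rat => p; apply: measurableC.
  have [pn|pn] := boolP (0 < (ratr p : R) < b n).
    rewrite (_ : [set t | _] = [set t | `|H (ratr p) t - H (b n.+1) t| <= b k]).
      by apply: measurable_set_ler; mfun.
    by apply/seteqP; split => t /=; [apply|].
  rewrite (_ : [set t | _] = setT)//; exact/seteqP.
have b_cvg : b n @[n --> \oo] --> (0 : R) by exact: cvg_harmonic.
have cvgD t : D t <-> cvg (H e t @[e --> 0^'+]).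
  split=> [Dt|/cvg_ex[l /cvgrPdist_le lt] k _].
    apply/cauchy_cvgP/cauchy_exP => d d0.
    have [k kd] : exists k, b k < d / 2.
      move/cvgr0Pnorm_lt : b_cvg => /(_ (d / 2)) [|k _ /(_ k (leqnn k))].
        by rewrite divr_gt0.
      by rewrite ger0_norm ?(ltW (b0 _))// => h; exists k.
    have [n _ nP] := Dt k I; exists (H (b n.+1) t).
    suff : \forall e \near 0^'+, ball (H (b n.+1) t) d (H e t) by [].
    near=> e; have e0 : 0 < e by [].
    have en : e < b n by near: e; apply: nbhs_right_lt; exact: b0.
    have d2 : 0 < d / 2 by rewrite divr_gt0.
    have /cvgrPdist_lt /(_ _ d2) [r /= r0 rP] := Hright t e e0.
    have : e < Num.min (e + r) (b n) by rewrite lt_min ltrDl r0.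
    move=> /rat_in_itvoo [p]; rewrite in_itv/= lt_min => /andP[ep /andP[per pn]].
    have p0 : 0 < (ratr p : R) < b n by rewrite pn (lt_trans e0).
    have h1 := nP p I p0.
    have h2 : `|H e t - H (ratr p) t| < d / 2.
      by apply: rP => //=; rewrite ltr_distlC; lra.
    rewrite /ball/= (_ : _ - _ = - (H e t - H (ratr p) t) - (H (ratr p) t - H (b n.+1) t)); last by ring.
    apply: le_lt_trans (ler_normB _ _) _; rewrite normrN; lra.
  have k2 : 0 < b k / 2 by rewrite divr_gt0.
  have [r /= r0 rP] := lt _ k2.
  have [n nr] : exists n, b n < r.
    move/cvgr0Pnorm_lt : b_cvg => /(_ r r0) [n _ /(_ n (leqnn n))].
    by rewrite ger0_norm ?(ltW (b0 _))// => h; exists n.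
  exists n => // p _ /= /andP[p0 pn].
  have bn : b n.+1 < b n by rewrite ltf_pV2 ?posrE// ltr_nat.
  have q x : 0 < x -> x < b n -> `|l - H x t| <= b k / 2.
    by move=> x0 xn; apply: rP => //=; rewrite sub0r normrN gtr0_norm//; lra.
  have h1 := q _ p0 pn; have h2 := q _ (b0 n.+1) bn.
  rewrite (_ : _ - _ = (l - H (b n.+1) t) - (l - H (ratr p) t)); last by ring.
  apply: le_trans (ler_normB _ _) _; lra.
apply: (@measurable_fun_cvg _ _ _ _
  (fun n t => H (b n) t * \1_D t + (point : R) * \1_(~` D) t)) => [n|t _].
- apply: measurable_funD; apply: measurable_funM => //.
  by apply/measurable_indicP; exact: measurableC.
- rewrite !indicE; have [Dt|Dt] := pselect (D t).
    rewrite (mem_set Dt) memNset; last by move=> /(_ Dt).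
    under eq_fun do rewrite mulr1 mulr0 addr0.
    have /cvg_at_rightP /(_ b) := (cvgD t).1 Dt.
    by apply; split.
  rewrite memNset// (mem_set (A := ~` D))//.
  rewrite (dvgP (contra_not (cvgD t).2 Dt)).
  by under eq_fun do rewrite mulr0 mulr1 add0r; exact: cvg_cst.
Unshelve. all: by end_near. Qed.

(** The truncation is an open condition, so enlarging [e] slightly changes nothing
    at a given point; the kernels for larger [e] are dominated by the one for [e]. *)
Lemma truncated_hilbert_right_cvg f x e : sqint f -> 0 < e ->
  \int[mu]_t (f t * hilbert_kernel p x t) @[p --> e^'+] -->
  \int[mu]_t (f t * hilbert_kernel e x t).
Proof.
move=> sf e0; have [mf _] := sf; apply/cvg_at_rightP => u [ue ucvg].
have mk p : measurable_fun setT (EFin \o (fun t => f t * hilbert_kernel p x t)).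
  apply/measurable_EFinP; apply: measurable_funM => //; exact: measurable_hilbert_kernel.
have ik p : 0 < p -> integrableR (fun t => f t * hilbert_kernel p x t).
  by move=> p0; apply: sqint_integrableM => //; exact: sqint_hilbert_kernel.
have un0 n : 0 < u n by exact: lt_trans (ue n).
have kE p t : hilbert_kernel p x t = if p < `|x - t| then (x - t)^-1 else 0.
  rewrite /hilbert_kernel indicE.
  have -> : (t \in [set s | p < `|x - s|]) = (p < `|x - t|) by apply/idP/idP; rewrite inE.
  by case: ifP; rewrite ?mulr1 ?mulr0.
have kcvg : {ae mu, forall t, setT t -> (EFin \o (fun t => f t * hilbert_kernel (u n) x t)) t
    @[n --> \oo] --> (EFin \o (fun t => f t * hilbert_kernel e x t)) t}.
  apply: aeW => t _; apply: cvg_near_cst; case: (ltP e `|x - t|) => et.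
    near=> n; rewrite /= !kE et ifT//.
    near: n; move/cvgrPdist_lt : ucvg => /(_ (`|x - t| - e)).
    rewrite subr_gt0 => /(_ et); apply: filterS => n; rewrite ltr_distlC; lra.
  have F p : e <= p -> (p < `|x - t|) = false.
    by move=> ep; apply/negbTE; rewrite -leNgt (le_trans et).
  by apply: nearW => n; rewrite /= !kE !F// ltW.
have kdom : {ae mu, forall t n, setT t -> (`|(f t * hilbert_kernel (u n) x t)%:E| <=
     (`|f t * hilbert_kernel e x t|%R)%:E)%E}.
  apply: aeW => t n _; rewrite /= lee_fin !kE; case: ifPn => [h|_].
    by rewrite ifT// (lt_trans _ h).
  by rewrite mulr0 normr0.
have [_ _] := @dominated_convergence _ _ _ mu setT measurableT _ _ _ (fun n => mk (u n)) (mk e) kcvg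
  (integrableR_norm (ik e e0)) kdom.
rewrite -(EFin_Rintegral (ik e e0)).
by move=> /fine_cvg.
Unshelve. all: by end_near. Qed.

Lemma measurable_hilbert f : sqint f -> measurable_fun setT (hilbert f).
Proof.
move=> sf; have [mf _] := sf; rewrite /hilbert.
pose H e t := pi^-1 * \int[mu]_s (f s * hilbert_kernel e t s).
rewrite (_ : (fun t => _) = fun t => lim (H e t @[e --> 0^'+])); last first.
  by apply/funext => t; under eq_fun do rewrite truncated_hilbertE.
apply: measurable_lim_at_right => [e|t e e0].
  apply: measurable_funM => //.
  apply: (measurable_Rintegral_param (g := fun z => f z.2 * hilbert_kernel e z.1 z.2)).
  apply: measurable_funM; first by apply: (measurableT_comp mf); mfun.
  rewrite (_ : (fun z => _) = fun z : R * R =>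
      (z.1 - z.2)^-1 * \1_[set y : R * R | e < `|y.1 - y.2|] z).
    apply: measurable_funM; first by mfun.
    by apply/measurable_indicP; apply: measurable_set_ltr; mfun.
  by apply/funext => z; rewrite /hilbert_kernel !indicE; congr (_ * (nat_of_bool _)%:R);
    apply/idP/idP; rewrite !inE.
apply: cvgM; first exact: cvg_cst.
exact: truncated_hilbert_right_cvg.
Qed.

End hilbert_measurable.

(** * From Hartley to Fourier *)

Section fourier_of_hartley.
Context {R : realType}.
Notation mu := (@lebesgue_measure R).
Implicit Types (f g h : R -> R) (F G : R -> R[i]).
Local Open Scope complex_scope.

Lemma sqr_normc (z : R[i]) :
  ComplexField.Normc.normc z ^+ 2 = complex.Re z ^+ 2 + complex.Im z ^+ 2.
Proof. by case: z => a b; rewrite /ComplexField.Normc.normc/= sqr_sqrtr// addr_ge0 ?sqr_ge0. Qed.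

Lemma energyE F : cmeasurable F -> energy F =
  (sqnorm (fun w => complex.Re (F w)) + sqnorm (fun w => complex.Im (F w)))%E.
Proof.
move=> [mRe mIm]; rewrite /sqnorm -ge0_integralD//; try exact: measurable_fun_sqr_EFin.
- by apply: eq_integral => w _; rewrite sqr_normc EFinD.
- by move=> w _; rewrite lee_fin sqr_ge0.
- by move=> w _; rewrite lee_fin sqr_ge0.
Qed.

Lemma cmeasurable_to_complex f : cmeasurable (to_complex f) <-> measurable_fun setT f.
Proof. by split=> [[]//|mf]; split. Qed.

Lemma energy_to_complex f : energy (to_complex f) = sqnorm f.
Proof. by apply: eq_integral => t _; rewrite sqr_normc/= expr0n addr0. Qed.

Lemma L2_to_complex f : L2 (to_complex f) <-> sqint f.
Proof. by rewrite /L2 /sqint energy_to_complex cmeasurable_to_complex. Qed.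

(** The even part of the Hartley transform is the cosine transform and the odd part
    is the sine transform. *)
Definition fourier_of h (w : R) : R[i] :=
  ((h w + h (- w)) / 2) +i* (- ((h w - h (- w)) / 2)).

Lemma measurable_flip h : measurable_fun setT h -> measurable_fun setT (fun w : R => h (- w)).
Proof. by move=> mh; apply: (measurableT_comp mh); mfun. Qed.

Lemma cmeasurable_fourier_of h : measurable_fun setT h -> cmeasurable (fourier_of h).
Proof. by move=> mh; have mN := measurable_flip mh; split; rewrite /fourier_of/=; mfun. Qed.

Lemma sqr_normc_fourier_of h w : ComplexField.Normc.normc (fourier_of h w) ^+ 2 =
  (h w ^+ 2 + h (- w) ^+ 2) / 2.
Proof. by rewrite sqr_normc/=; field. Qed.

(** The reflection [w |-> - w] preserves the energy, so averaging [h w ^ 2] with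
    [h (- w) ^ 2] changes nothing. *)
Lemma energy_fourier_of h : measurable_fun setT h -> energy (fourier_of h) = sqnorm h.
Proof.
move=> mh; have mN := measurable_flip mh; rewrite /energy.
transitivity (\int[mu]_w ((2^-1)%:E * (h w ^+ 2)%:E + (2^-1)%:E * (h (- w)%R ^+ 2)%:E))%E.
  by apply: eq_integral => w _; rewrite sqr_normc_fourier_of -!EFinM -EFinD; congr EFin; ring.
have m1 := measurable_fun_sqr_EFin mh; have m2 := measurable_fun_sqr_EFin mN.
rewrite ge0_integralD//; last 4 first.
- by move=> w _; rewrite -EFinM lee_fin mulr_ge0// sqr_ge0.
- by apply/measurable_EFinP; mfun.
- by move=> w _; rewrite -EFinM lee_fin mulr_ge0// sqr_ge0.
- by apply/measurable_EFinP; mfun.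
rewrite !ge0_integralZl//; last 2 first.
- by move=> w _; rewrite lee_fin sqr_ge0.
- by move=> w _; rewrite lee_fin sqr_ge0.
rewrite -/(sqnorm h) -/(sqnorm (fun w => h (- w))) sqnorm_reflect//.
have [hoo|hoo] := eqVneq (sqnorm h) +oo%E.
  by rewrite hoo gt0_muley// ?lte_fin.
rewrite -(fineK (_ : sqnorm h \is a fin_num)); last first.
  by rewrite ge0_fin_numE ?sqnorm_ge0// ltey.
by rewrite -!EFinM -EFinD; congr EFin; field.
Qed.

Lemma fourier_ofB h g w : fourier_of h w - fourier_of g w = fourier_of (fun w => h w - g w) w.
Proof.
by apply/eqP; rewrite eq_complex/=; apply/andP; split; apply/eqP; field.
Qed.

Lemma truncated_fourierE f A w : sqint f ->
  truncated_fourier (to_complex f) A w = fourier_of (hart (trunc A f)) w.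
Proof.
move=> sf; have iT := integrable_trunc A sf; have mT := integrableR_measurable iT.
have ic : integrableR (fun t => trunc A f t * cos (w * t)).
  apply: le_integrableR (integrableR_norm iT); first by mfun.
  by move=> t; rewrite normrM ler_piMr// ler_norml cos_geN1 cos_le1.
have is_ : integrableR (fun t => trunc A f t * sin (w * t)).
  apply: le_integrableR (integrableR_norm iT); first by mfun.
  by move=> t; rewrite normrM ler_piMr// ler_norml sin_geN1 sin_le1.
have hp : hart (trunc A f) w = \int[mu]_t (trunc A f t * cos (w * t)) +
    \int[mu]_t (trunc A f t * sin (w * t)).
  by rewrite -RintegralD//; apply: eq_Rintegral => t _; rewrite -mulrDr.
have hm : hart (trunc A f) (- w) = \int[mu]_t (trunc A f t * cos (w * t)) -
    \int[mu]_t (trunc A f t * sin (w * t)).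
  rewrite -RintegralB//; apply: eq_Rintegral => t _.
  by rewrite /cas mulNr cosN sinN -mulrBr.
rewrite /truncated_fourier /cintegral /fourier_of hp hm.
congr Complex.
- transitivity (\int[mu]_t (trunc A f t * cos (w * t))); last by field.
  rewrite Rintegral_mkcond; apply: eq_Rintegral => t _.
  rewrite /patch /trunc indicE /= cosN; case: ifP => _; last by rewrite mulr0 mul0r.
  by rewrite mulr1 mul0r subr0.
- transitivity (- \int[mu]_t (trunc A f t * sin (w * t))); last by field.
  rewrite Rintegral_mkcond -[RHS]mulN1r -RintegralZl//; apply: eq_Rintegral => t _.
  rewrite /patch /trunc indicE /= sinN; case: ifP => _; last by rewrite mulr0 mul0r mulr0.
  by rewrite mulr1 mul0r addr0 mulrN mulN1r.
Qed.

Lemma is_fourier_of_is_hart f h : sqint f -> is_hart f h ->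
  is_fourier (to_complex f) (fourier_of h).
Proof.
move=> sf [[mh hy] fh]; have [mf _] := sf; split.
  by split; [exact: cmeasurable_fourier_of|rewrite energy_fourier_of].
rewrite (_ : (fun A => _) = fun A => sqnorm (fun w => hart (trunc A f) w - h w))//.
apply/funext => A; rewrite -energy_fourier_of; last first.
  by apply: measurable_funB => //; apply: measurable_hart; exact: measurable_trunc.
congr energy; apply/funext => w; rewrite -fourier_ofB truncated_fourierE//.
Qed.

Lemma is_fourier_unique f F G : sqint f ->
  is_fourier (to_complex f) F -> is_fourier (to_complex f) G ->
  {ae mu, forall w, F w = G w}.
Proof.
move=> sf [[cF Fy] fF] [[cG Gy] fG]; have [mf _] := sf.
have cT A : cmeasurable (truncated_fourier (to_complex f) A).
  rewrite (_ : truncated_fourier _ _ = fourier_of (hart (trunc A f))).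
    by apply: cmeasurable_fourier_of; apply: measurable_hart; exact: measurable_trunc.
  by apply/funext => w; rewrite truncated_fourierE.
have cB H A : cmeasurable H ->
    cmeasurable (fun w => truncated_fourier (to_complex f) A w - H w).
  move=> [mR mI]; have [tR tI] := cT A; split => /=.
    rewrite (_ : (fun t => _) = fun w => complex.Re (truncated_fourier (to_complex f) A w)
      - complex.Re (H w)); first exact: measurable_funB.
    by apply/funext => w; rewrite raddfB.
  rewrite (_ : (fun t => _) = fun w => complex.Im (truncated_fourier (to_complex f) A w)
    - complex.Im (H w)); first exact: measurable_funB.
  by apply/funext => w; rewrite raddfB.
have cvgRe H : cmeasurable H ->
    energy (fun w => truncated_fourier (to_complex f) A w - H w) @[A --> +oo] --> 0%E ->
    sqnorm (fun w => complex.Re (truncated_fourier (to_complex f) A w) - complex.Re (H w))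
      @[A --> +oo] --> 0%E.
  move=> cH; apply: (cvge0_le (c := 1)) => A; first exact: sqnorm_ge0.
  rewrite mul1e (energyE (cB H A cH)).
  rewrite (_ : (fun w => complex.Re (_ - _)) = fun w =>
    complex.Re (truncated_fourier (to_complex f) A w) - complex.Re (H w)).
    by rewrite leeDl// sqnorm_ge0.
  by apply/funext => w; rewrite raddfB.
have cvgIm H : cmeasurable H ->
    energy (fun w => truncated_fourier (to_complex f) A w - H w) @[A --> +oo] --> 0%E ->
    sqnorm (fun w => complex.Im (truncated_fourier (to_complex f) A w) - complex.Im (H w))
      @[A --> +oo] --> 0%E.
  move=> cH; apply: (cvge0_le (c := 1)) => A; first exact: sqnorm_ge0.
  rewrite mul1e (energyE (cB H A cH)).
  rewrite (_ : (fun w => complex.Im (_ - _)) = fun w =>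
    complex.Im (truncated_fourier (to_complex f) A w) - complex.Im (H w)).
    by rewrite leeDr// sqnorm_ge0.
  by apply/funext => w; rewrite raddfB.
have re : {ae mu, forall w, complex.Re (F w) = complex.Re (G w)}.
  exact: (L2_limit_unique (fun A => (cT A).1) cF.1 cG.1 (cvgRe F cF fF) (cvgRe G cG fG)).
have im : {ae mu, forall w, complex.Im (F w) = complex.Im (G w)}.
  exact: (L2_limit_unique (fun A => (cT A).2) cF.2 cG.2 (cvgIm F cF fF) (cvgIm G cG fG)).
apply: aeS (aeI re im) => w [r i]; by apply/eqP; rewrite eq_complex r i !eqxx.
Qed.

Lemma fourier_ae_eq f h : sqint f -> is_hart f h ->
  cmeasurable (fourier (to_complex f)) /\
  {ae mu, forall w, fourier (to_complex f) w = fourier_of h w}.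
Proof.
move=> sf fh; have H := is_fourier_of_is_hart sf fh.
have FF : is_fourier (to_complex f) (fourier (to_complex f)).
  by rewrite /fourier; apply: xgetPex; exists (fourier_of h).
by split; [case: FF => -[]|exact: is_fourier_unique FF H].
Qed.

(** The representative chosen by [fourier] agrees almost everywhere with the one
    built from [h]. *)
Lemma admissibilityE f h : sqint f -> is_hart f h ->
  admissibility (to_complex f) =
  (\int[mu]_w ((h w ^+ 2 + h (- w) ^+ 2) / 2 / `|w|)%:E)%E.
Proof.
move=> sf fh; have [[mR mI] FE] := fourier_ae_eq sf fh; have [[mh _] _] := fh.
have mN := measurable_flip mh.
apply: ge0_ae_eq_integral => //.
- apply/measurable_EFinP; apply: measurable_funM; last by mfun.
  rewrite (_ : (fun w => _) = fun w => complex.Re (fourier (to_complex f) w) ^+ 2 +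
    complex.Im (fourier (to_complex f) w) ^+ 2); first by mfun.
  by apply/funext => w; rewrite sqr_normc.
- by apply/measurable_EFinP; mfun.
- by move=> w _; rewrite lee_fin divr_ge0// sqr_ge0.
- by move=> w _; rewrite lee_fin !divr_ge0// addr_ge0// sqr_ge0.
- by apply: aeS FE => w -> _; rewrite sqr_normc_fourier_of.
Qed.

End fourier_of_hartley.

(** * The Hartley-like wavelet *)

Section hartley_like.
Context {R : realType}.
Notation mu := (@lebesgue_measure R).
Implicit Types (f g h : R -> R) (s : bool).

Definition hartley_like_hart s h (w : R) : R :=
  (Num.sqrt 2)^-1 * (h w - (-1) ^+ s * sgflip h w).

(** The cross terms at [w] and [- w] are opposite because [Num.sg] is odd. The case
    [w = 0] is excluded since there the sign vanishes. *)
Lemma sqr_hartley_like_hart s h w : w != 0 ->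
  hartley_like_hart s h w ^+ 2 + hartley_like_hart s h (- w) ^+ 2 =
  h w ^+ 2 + h (- w) ^+ 2.
Proof.
move=> w0; rewrite /hartley_like_hart /sgflip opprK sgrN !exprMn exprVn sqr_sqrtr//.
have : Num.sg w ^+ 2 = 1 by rewrite sqr_sg w0.
have : ((-1) ^+ s : R) ^+ 2 = 1 by rewrite sqrr_sign.
move: (Num.sg w) ((-1) ^+ s : R) (h w) (h (- w)) => a b x y b2 a2.
have -> : 2^-1 * (x - b * (a * y)) ^+ 2 + 2^-1 * (y - b * (- a * x)) ^+ 2 =
    2^-1 * (x ^+ 2 + y ^+ 2) * (1 + b ^+ 2 * a ^+ 2) by ring.
by rewrite a2 b2; field.
Qed.

(** The pointwise principal value may be replaced by the square-integrable function
    [g] with transform [sgflip h], with which it agrees almost everywhere. *)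
Lemma is_hart_hartley_like s f h : sqint f -> is_hart f h ->
  sqint (hartley_like s f) /\ is_hart (hartley_like s f) (hartley_like_hart s h).
Proof.
move=> sf fh; have [sh _] := fh; have [mf _] := sf.
have [g sg gk] := is_hart_surjective (sqint_sgflip sh).
have Hg := hilbert_ae_eq sf sg fh gk; have mH := measurable_hilbert sf.
have [mg _] := sg.
have sZ := sqintZ ((-1) ^+ s) sg; have gZ := is_hartZ ((-1) ^+ s) sg gk.
have sB := sqintZ (Num.sqrt 2)^-1 (sqintB sf sZ).
have gB := is_hartZ (Num.sqrt 2)^-1 (sqintB sf sZ) (is_hartB sf sZ fh gZ).
have ae : {ae mu, forall t, (Num.sqrt 2)^-1 * (f t - (-1) ^+ s * g t) = hartley_like s f t}.
  by apply: aeS Hg => t; rewrite /hartley_like => ->.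
have mB := sB.1.
have mL : measurable_fun setT (hartley_like s f) by rewrite /hartley_like; mfun.
split; last exact: is_hart_ae_eql gB mB mL ae.
by split => //; rewrite -(eq_ae_sqnorm mB mL ae); case: sB.
Qed.

Lemma ae_neq0 : {ae mu, forall w : R, w != 0}.
Proof.
exists [set 0]; split => //; first by rewrite lebesgue_measure_set1.
by move=> w /= /negP; rewrite negbK => /eqP.
Qed.

Lemma sqnorm_hartley_like_hart s h : measurable_fun setT h ->
  sqnorm (hartley_like_hart s h) = sqnorm h.
Proof.
move=> mh; have mN := measurable_flip mh.
have mL : measurable_fun setT (hartley_like_hart s h).
  by rewrite /hartley_like_hart /sgflip; mfun.
have mLN := measurable_flip mL.
rewrite -!energy_fourier_of// /energy.
under eq_integral do rewrite sqr_normc_fourier_of.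
under [RHS]eq_integral do rewrite sqr_normc_fourier_of.
apply: ge0_ae_eq_integral => //.
- by apply/measurable_EFinP; mfun.
- by apply/measurable_EFinP; mfun.
- by move=> w _; rewrite lee_fin divr_ge0// addr_ge0// sqr_ge0.
- by move=> w _; rewrite lee_fin divr_ge0// addr_ge0// sqr_ge0.
- by apply: aeS ae_neq0 => w w0 _; rewrite sqr_hartley_like_hart.
Qed.

End hartley_like.

Theorem proposition5 (R : realType) (psi : R -> R) (s : bool) :
  real_wavelet psi ->
  [/\ real_wavelet (hartley_like s psi),
      energy (to_complex (hartley_like s psi)) = energy (to_complex psi) &
      admissibility (to_complex (hartley_like s psi)) =
        admissibility (to_complex psi)].
Proof.
move=> [/L2_to_complex sf Cy].
have [h fh _] := is_hart_exists sf; have [sL Lh] := is_hart_hartley_like s sf fh.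
have E : energy (to_complex (hartley_like s psi)) = energy (to_complex psi).
  have := sqnorm_is_hart sL Lh; have [[mh _] _] := fh.
  rewrite sqnorm_hartley_like_hart// (sqnorm_is_hart sf fh) !energy_to_complex.
  rewrite !EFin_sqnorm// -!EFinM => -[] /mulfI ->//.
  by rewrite gt_eqF// mulr_gt0// pi_gt0.
have C : admissibility (to_complex (hartley_like s psi)) = admissibility (to_complex psi).
  rewrite (admissibilityE sL Lh) (admissibilityE sf fh).
  apply: eq_integral => w _; have [->|w0] := eqVneq w 0.
    by rewrite normr0 invr0 !mulr0.
  by rewrite sqr_hartley_like_hart.
split; [|exact: E|exact: C].
by split; [exact/L2_to_complex|rewrite C].
Qed.
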